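(* Let $w\in A_p(\mu)$ for some $p\in(1,\infty)$. Then $\mathcal{M}_\mu$ is bounded on $L^p_\mu(w)$. Moreover, if $w\in A_1(\mu)$, then $\mathcal{M}_\mu$ is bounded from $L^1_\mu(w)$ to $L^{1,\infty}_\mu(w)$.
   Context: Tree and flow measure. $T$ is (the vertex set of) an infinite tree, i.e. an infinite connected graph with no loops; it is not assumed to be locally finite. $d$ is the geodesic distance and $x\sim y$ means $d(x,y)=1$. $\partial T$ is the boundary of $T$ (equivalence classes of semi-infinite geodesics, two being equivalent if they eventually coincide). Fix $\omega_*\in\partial T$; $[x,\omega_* )$ is the semi-infinite geodesic from $x$ to $\omega_*$, and $x\le y$ means $y\in[x,\omega_* )$. Fix $o\in T$, enumerate $[o,\omega_* )=\{x_j\}_{j\in\mathbb N}$ with $x_0=o$ and $d(x_j,x_k)=|j-k|$, and define the level $\ell(x)=\lim_{j\to\infty}(j-d(x,x_j))$. The set of successors of $x$ is $s(x)=\{y\sim x:\ell(y)=\ell(x)-1\}$. A flow measure is a positive function $\mu$ on $T$ with $\mu(x)=\sum_{y\in s(x)}\mu(y)$ for all $x\in T$; $\mu(E)=\sum_{y\in E}\mu(y)$. A flow measure $\mu$ is fixed (no doubling assumption). A weight is a positive function on $T$. Trapezoids. Fix a number $\beta\ge 12$. For $x\in T$ and $h_1,h_2\in\mathbb N$, $h_1<h_2$, the trapezoid with root $x$ and heights $h_1,h_2$ is $R_{h_1}^{h_2}(x)=\{y\in T: y\le x,\ h_1\le d(x,y)<h_2\}$. It is admissible if $2\le h_2/h_1\le\beta$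 (so $h_1\ge1$). $\mathcal R$ is the family of all admissible trapezoids and all singletons. Weights. For a weight $w$ and $E\subset T$, $w_\mu(E)=\sum_{y\in E}w(y)\mu(y)$. For $p\in(1,\infty)$, $w\in A_p(\mu)$ means $$[w]_{A_p(\mu)}=\sup_{R\in\mathcal R}\Big(\frac1{\mu(R)}\sum_{y\in R}w(y)\mu(y)\Big)\Big(\frac1{\mu(R)}\sum_{y\in R}w(y)^{-1/(p-1)}\mu(y)\Big)^{p-1}<\infty,$$ and $w\in A_1(\mu)$ means $[w]_{A_1(\mu)}=\sup_{R\in\mathcal R}\frac{w_\mu(R)}{\mu(R)}\|w^{-1}\|_{L^\infty(R)}<\infty$. Maximal operator: $\mathcal M_\mu f(x)=\sup_{R\in\mathcal R,\ x\in R}\frac1{\mu(R)}\sum_{y\in R}|f(y)|\mu(y)$. The spaces $L^p_\mu(w)$ and $L^{p,\infty}_\mu(w)$ are the Lebesgue and weak Lebesgue spaces on $T$ with respect to the measure $w\mu$. *)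

(* Defs.v *)
From mathcomp Require Import all_boot all_order all_algebra.
From mathcomp Require Import all_classical all_reals all_analysis.

Set Implicit Arguments.
Unset Strict Implicit.
Unset Printing Implicit Defensive.

Import Order.TTheory GRing.Theory Num.Theory. 
Import numFieldNormedType.Exports.

Local Open Scope classical_set_scope.
Local Open Scope ring_scope.

Section Tree.
Context {T : choiceType}.
Variable adj : rel T.

Definition walk_of_length (x y : T) : set nat :=
  [set n | exists p : seq T, [/\ path adj x p, last x p = y & size p = n]].

(* A uniq cycle of size at most 2 is a vertex or an edge run back and forth. *)
Definition is_tree : Prop :=
  [/\ symmetric adj, irreflexive adj,
      forall x y, exists n, walk_of_length x y n
    & forall c : seq T, ucycle adj c -> (size c <= 2)%N].

(* Length of a shortest walk; the default 0 is never used in a connected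
   graph. *)
Definition gdist (x y : T) : nat :=
  xget 0%N [set n | walk_of_length x y n /\
                    forall m, walk_of_length x y m -> (n <= m)%N].

Definition geodesic_ray (g : nat -> T) : Prop :=
  forall j k, gdist (g j) (g k) = `|j%:Z - k%:Z|%N.

Definition ray_equiv (g h : nat -> T) : Prop :=
  exists m n : nat, forall k : nat, g (m + k)%N = h (n + k)%N.

Definition boundary : set (set (nat -> T)) :=
  [set [set h | geodesic_ray h /\ ray_equiv g h] | g in geodesic_ray].

(* The vertices of [x, omega). *)
Definition ray_to (omega : set (nat -> T)) (x : T) : set T :=
  [set y | exists g, [/\ omega g, g 0%N = x & exists j, g j = y]].

Definition below (omega : set (nat -> T)) (x y : T) : Prop :=
  ray_to omega x y.

Definition trapezoid (omega : set (nat -> T)) (h1 h2 : nat) (x : T) : set T :=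
  [set y | below omega y x /\ (h1 <= gdist x y < h2)%N].

Section Reals.
Context {R : realType}.

(* xs enumerates [o, omega), with xs 0 = o. *)
Definition level (xs : nat -> T) (x : T) : R :=
  lim ((j%:R - (gdist x (xs j))%:R : R) @[j --> \oo]).

Definition successors (xs : nat -> T) (x : T) : set T :=
  [set y | gdist x y = 1%N /\ level xs y = level xs x - 1].

Definition flow_measure (xs : nat -> T) (mu : T -> R) : Prop :=
  (forall x, 0 < mu x) /\
  (forall x, (mu x)%:E = \esum_(y in successors xs x) (mu y)%:E).

Definition admissible (beta : R) (h1 h2 : nat) : Prop :=
  [/\ (0 < h1)%N, (h1 < h2)%N, 2 <= h2%:R / h1%:R :> R & h2%:R / h1%:R <= beta].

Definition trapezoids (omega : set (nat -> T)) (beta : R) : set (set T) :=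
  [set E | (exists x, E = [set x]) \/
           (exists x h1 h2, admissible beta h1 h2 /\
                            E = trapezoid omega h1 h2 x)].

End Reals.
End Tree.

Section Weights.
Context {R : realType} {T : choiceType}.
Variables (fam : set (set T)) (mu : T -> R).
Local Open Scope ereal_scope.

Definition mass (nu : T -> R) (E : set T) : \bar R := \esum_(y in E) (nu y)%:E.

Definition wmul (w : T -> R) : T -> R := fun y => (w y * mu y)%R.

Definition average (g : T -> R) (E : set T) : \bar R :=
  mass (wmul g) E / mass mu E.

Definition weight (w : T -> R) : Prop := forall x, (0 < w x)%R.

Definition Ap_const (p : R) (w : T -> R) : \bar R :=
  ereal_sup [set average w E *
    (average (fun y => w y `^ (- (p - 1)^-1))%R E) `^ (p - 1)%R | E in fam].

Definition in_Ap (p : R) (w : T -> R) : Prop := weight w /\ Ap_const p w < +oo.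

(* Essential supremum over E with respect to mu. *)
Definition Linfty_norm (E : set T) (g : T -> R) : \bar R :=
  ereal_inf [set M | 0 <= M /\ mass mu (E `&` [set y | M < `|g y|%:E]) = 0].

Definition A1_const (w : T -> R) : \bar R :=
  ereal_sup [set average w E * Linfty_norm E (fun y => (w y)^-1%R) | E in fam].

Definition in_A1 (w : T -> R) : Prop := weight w /\ A1_const w < +oo.

Definition maximal (f : T -> R) (x : T) : \bar R :=
  ereal_sup [set average (fun y => `|f y|%R) E | E in fam `&` [set E | E x]].

(* Norms for the measure w * mu, of extended real functions since the maximal
   function may take the value +oo. *)
Definition Lp_norm (p : R) (w : T -> R) (g : T -> \bar R) : \bar R :=
  (\esum_(y in [set: T]) (`|g y| `^ p * (wmul w y)%:E)) `^ p^-1%R.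

Definition weak_Lp_norm (p : R) (w : T -> R) (g : T -> \bar R) : \bar R :=
  ereal_sup [set t%:E * (mass (wmul w) [set y | t%:E < `|g y|]) `^ p^-1%R
            | t in [set t : R | (0 < t)%R]].

Definition bounded_Lp (p : R) (w : T -> R) (op : (T -> R) -> T -> \bar R)
    : Prop :=
  exists C : R, forall f : T -> R,
    Lp_norm p w (EFin \o f) < +oo ->
    Lp_norm p w (op f) <= C%:E * Lp_norm p w (EFin \o f).

Definition bounded_Lp_weak (p : R) (w : T -> R) (op : (T -> R) -> T -> \bar R)
    : Prop :=
  exists C : R, forall f : T -> R,
    Lp_norm p w (EFin \o f) < +oo ->
    weak_Lp_norm p w (op f) <= C%:E * Lp_norm p w (EFin \o f).

End Weights.

(* Main.v *)
Require Import Defs.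
From mathcomp Require Import all_boot all_order all_algebra.
From mathcomp Require Import all_classical all_reals all_analysis.
From mathcomp Require Import zify ring lra.
Import Order.TTheory GRing.Theory Num.Theory.
Import numFieldNormedType.Exports.
Local Open Scope classical_set_scope.
Local Open Scope ring_scope.

Set Implicit Arguments.
Unset Strict Implicit.
Unset Printing Implicit Defensive.

(** The end [omega] turns the tree into a genealogy: every vertex has a parent,
the next vertex on its ray to [omega] ([tree_parent]), and a trapezoid is a band
of consecutive generations below its root. By the flow condition every
generation below [x] has mass [mu x], so the mass of a band is its number of
generations times the mass of its root ([mass_band]).

The covering argument compares bands by the level of their roots and not by
their size. If two bands meet, their roots are both ancestors of a common
vertex, hence one root lies below the other, and the band with the lower root is
contained in an envelope of the other band, which has the same root and heights
changed by bounded factors ([meeting_sub_envelope]). Selecting bands greedily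
from the highest root downwards gives the weak type inequality for every measure
[nu] whose mass of the envelope is controlled by that of the band
([cover_highest_first], [covering_bound_indexed]). Only bands with the same root
are compared here, and a chain of dyadic bands reduces the control to pairs of
nested admissible bands ([mass_envelope]).

For a weight in $A_p$ both [w mu] and [s mu], where [s] is the dual weight
[w `^ (- (p - 1)^-1)], have this property: the product of masses in the $A_p$
condition is comparable to a power of the [mu]-mass, from above by hypothesis and
from below for every set, and the two factors are monotone in the set
([Ap_doubling]). The maximal operators formed with [w mu] and [s mu] are then of
strong type $(q, q)$ for all [q > 1] by interpolation along dyadic layers
([weighted_maximal_strong]). As Lerner observed, the $A_p$ condition bounds the maximal function
of [f] pointwise by a power of an iterate of these two weighted maximal operators
([maximal_le_iterated]), and applying their boundedness in turn, with exponents
[p / (p - 1)] and [p], gives the result ([Ap_strong_bound]). For $A_1$ the average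
of [|f|] over a band is bounded by a multiple of its [w mu] average, so the
covering argument applies directly ([A1_weak_bound]). *)

(** * Geodesic rays of a tree *)

Section Graph.
Context {T : choiceType}.
Variable adj : rel T.

Lemma cycle_mkseq (f : nat -> T) n : f n = f 0%N ->
  (forall i, (i < n)%N -> adj (f i) (f i.+1)) -> cycle adj (mkseq f n).
Proof.
case: n => // n fn step.
have pathf i k : (forall j, (i <= j < i + k)%N -> adj (f j) (f j.+1)) ->
    path adj (f i) (map f (iota i.+1 k)).
  elim: k i => //= k IH i H; rewrite H ?leqnn ?addnS ?leq_addr ?ltnS//= IH//.
  by move=> j /andP[ij jk]; apply: H; rewrite (ltnW ij) addnS -addSn.
rewrite /mkseq /= (_ : rcons _ _ = map f (iota 1 n.+1)).
  by apply: pathf => j /andP[_]; rewrite add0n; exact: step.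
by rewrite -fn -[in RHS](addn1 n) iotaD map_cat /= cats1 add1n.
Qed.

Hypothesis adj_sym : symmetric adj.
Hypothesis adj_connected : forall x y, exists n, walk_of_length adj x y n.
Local Notation d := (gdist adj).

Lemma gdistP x y :
  walk_of_length adj x y (d x y) /\
  forall m, walk_of_length adj x y m -> (d x y <= m)%N.
Proof.
apply: (@xgetPex _ 0%N [set n | walk_of_length adj x y n /\
  forall m, walk_of_length adj x y m -> (n <= m)%N]).
have ex : exists n, `[< walk_of_length adj x y n >].
  by have [n nP] := adj_connected x y; exists n; apply/asboolP.
case: (ex_minnP ex) => n /asboolP nP nmin; exists n; split=> // m mP.
by apply: nmin; apply/asboolP.
Qed.

Lemma gdist_le x y n : walk_of_length adj x y n -> (d x y <= n)%N.
Proof. by case: (gdistP x y) => _; exact. Qed.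

Lemma gdistxx x : d x x = 0%N.
Proof. by apply/eqP; rewrite -leqn0; apply: gdist_le; exists [::]. Qed.

Lemma gdist_triangle y x z : (d x z <= d x y + d y z)%N.
Proof.
have [[p [pp lp <-]] _] := gdistP x y; have [[q [pq lq <-]] _] := gdistP y z.
apply: gdist_le; exists (p ++ q).
by split; rewrite ?size_cat// ?last_cat ?cat_path ?lp// pp.
Qed.

Lemma gdist_adj x y : adj x y -> (d x y <= 1)%N.
Proof. by move=> xy; apply: gdist_le; exists [:: y]; rewrite /= xy. Qed.

Lemma adj_gdist1 x y : d x y = 1%N -> adj x y.
Proof.
have [[p [pp lp sp]] _] := gdistP x y => d1; move: pp lp sp; rewrite d1.
by case: p => // z [|//] /= /[!andbT] + <-.
Qed.

Lemma gdist_sym x y : d x y = d y x.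
Proof.
suff H u v : (d u v <= d v u)%N by apply/eqP; rewrite eqn_leq !H.
have [[p [pp lp <-]] _] := gdistP v u; apply: gdist_le.
exists (rev (belast v p)); split; last by rewrite size_rev size_belast.
- rewrite -lp rev_path; apply: sub_path pp => a b /=; by rewrite adj_sym.
- by case: p pp lp => //= a p _ _; rewrite rev_cons last_rcons.
Qed.

Lemma ray_adj g i : geodesic_ray adj g -> adj (g i) (g i.+1).
Proof. by move=> gg; apply: adj_gdist1; rewrite gg; lia. Qed.

Lemma steps_gdist_le h i k : (forall i, adj (h i) (h i.+1)) -> (d (h i) (h (i + k)%N) <= k)%N.
Proof.
move=> step; elim: k => [|k IH]; first by rewrite addn0 gdistxx.
apply: leq_trans (gdist_triangle (h (i + k)%N) _ _) _.
by rewrite addnS -[leqRHS]addn1 leq_add// gdist_adj.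
Qed.

(** A far enough end point at the right distance leaves no slack in the triangle
inequality, so that all intermediate distances are exact. *)
Lemma geodesic_ray_steps h : (forall i, adj (h i) (h i.+1)) ->
  (forall N, exists2 n, (N <= n)%N & d (h 0%N) (h n) = n) -> geodesic_ray adj h.
Proof.
move=> step far.
have main i j : (i <= j)%N -> d (h i) (h j) = (j - i)%N.
  move=> ij; have [n jn dn] := far j.
  have := gdist_triangle (h i) (h 0%N) (h n).
  have := gdist_triangle (h j) (h i) (h n).
  have := @steps_gdist_le h 0 i step; have := @steps_gdist_le h j (n - j) step.
  have := @steps_gdist_le h i (j - i) step.
  rewrite !subnKC// add0n dn; lia.
move=> i j; have [ij|/ltnW ji] := leqP i j; first by rewrite main//; lia.
by rewrite gdist_sym main//; lia.
Qed.

Lemma geodesic_ray_shift g n : geodesic_ray adj g ->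
  geodesic_ray adj (fun k => g (n + k)%N).
Proof. by move=> gg j k; rewrite gg; lia. Qed.

(** The quantity [d x (g j) - j] is nonincreasing and bounded below, hence
constant from some [J] on; a shortest path from [x] to [g J] followed by [g] is
then a geodesic ray. *)
Lemma ray_from g x : geodesic_ray adj g ->
  exists h, [/\ geodesic_ray adj h, h 0%N = x & ray_equiv g h].
Proof.
move=> gg; pose D j := (d x (g j) + d x (g 0%N) - j)%N.
have stepg j : (d x (g j.+1) <= (d x (g j)).+1)%N.
  apply: leq_trans (gdist_triangle (g j) _ _) _.
  by rewrite -[leqRHS]addn1 leq_add2l gdist_adj// ray_adj.
have Dge j : (j <= d x (g j) + d x (g 0%N))%N.
  have := gdist_triangle x (g 0%N) (g j); rewrite gg (gdist_sym (g 0%N)); lia.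
have ex : exists n, `[< exists j, D j = n >] by exists (D 0%N); apply/asboolP; exists 0%N.
case: (ex_minnP ex) => n /asboolP[J DJ] nmin.
have dJ k : d x (g (J + k)%N) = (d x (g J) + k)%N.
  elim: k => [|k IH]; first by rewrite !addn0.
  have : (n <= D (J + k.+1)%N)%N by apply: nmin; apply/asboolP; exists (J + k.+1)%N.
  have := stepg (J + k)%N; have := Dge (J + k.+1)%N; have := Dge J.
  rewrite -DJ /D -addnS; lia.
have [[p [pp lp sp]] _] := gdistP x (g J); set N := d x (g J) in sp dJ.
pose h i := if (i < N)%N then nth x (x :: p) i else g (J + (i - N))%N.
have hN k : h (N + k)%N = g (J + k)%N by rewrite /h ltnNge leq_addr/= addKn.
have h0 : h 0%N = x.
  rewrite /h; case: ltnP => //; rewrite leqn0 => /eqP N0.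
  by rewrite N0 addn0 -lp; move: sp; rewrite N0; case: (p).
exists h; split=> //; last by exists J, N => k; rewrite hN.
apply: geodesic_ray_steps => [i|M]; last first.
  by exists (N + M)%N; rewrite ?leq_addl// hN h0 dJ.
have [iN|Ni] := ltnP i N; last by rewrite -(subnKC Ni) -addnS !hN addnS ray_adj.
have hi : h i = nth x (x :: p) i by rewrite /h iN.
have hi1 : h i.+1 = nth x p i.
  rewrite /h; case: ltnP => // Ni1.
  have E : i.+1 = N by apply/eqP; rewrite eqn_leq iN.
  by rewrite E subnn addn0 -lp -nth_last sp -E.
by rewrite hi hi1; move/pathP: pp; apply; rewrite sp.
Qed.

Hypothesis acyclic : forall c, ucycle adj c -> (size c <= 2)%N.

(** If two rays with the same origin and the same end were different, the parts
between two consecutive meeting points would form a cycle. *)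
Lemma ray_unique h h' : geodesic_ray adj h -> geodesic_ray adj h' ->
  h 0%N = h' 0%N -> ray_equiv h h' -> h =1 h'.
Proof.
move=> gh gh' h0 [m [n E]].
have dh k : d (h 0%N) (h k) = k by rewrite gh; lia.
have dh' k : d (h 0%N) (h' k) = k by rewrite h0 gh'; lia.
(* Points of the two rays can coincide only at equal times, as times are
   distances to the origin. *)
have hh' k l : h k = h' l -> k = l by move=> kl; rewrite -(dh k) kl dh'.
have mn : m = n by have := hh' _ _ (E 0%N); rewrite !addn0.
subst n; move=> i; apply: contrapT => hi.
have exb : exists j, (i <= j)%N && (h j == h' j).
  by exists (m + i)%N; rewrite leq_addl E eqxx.
have exa : exists j, (j <= i)%N && (h j == h' j) by exists 0%N; rewrite h0 eqxx.
case: (ex_minnP exb) => b /andP[ib /eqP hb] bmin.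
have abnd j : (j <= i)%N && (h j == h' j) -> (j <= i)%N by case/andP.
case: (ex_maxnP exa abnd) => a /andP[ai /eqP ha] amax.
have ai' : (a < i)%N by rewrite ltn_neqAle ai andbT; apply/eqP => ai2; rewrite ai2 in ha.
have ib' : (i < b)%N by rewrite ltn_neqAle ib andbT; apply/eqP => ai2; rewrite -ai2 in hb.
have between k : (a < k < b)%N -> h k <> h' k.
  move=> /andP[ak kb] hk; have [ki|ik] := leqP k i.
    by have := amax k; rewrite ki hk eqxx => /(_ isT); rewrite leqNgt ak.
  by have := bmin k; rewrite (ltnW ik) hk eqxx => /(_ isT); rewrite leqNgt kb.
pose L := (b - a)%N.
(* The cycle runs along h from a to b - 1 and back along h' from b to a + 1; as a
   formula, f (L + L) is h' a, which is also f 0. *)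
pose f k := if (k < L)%N then h (a + k)%N else h' (b - (k - L))%N.
have f0 : f 0%N = h a by rewrite /f subn_gt0 (ltn_trans ai') ?addn0.
have : (size (mkseq f (L + L)) <= 2)%N; last by rewrite size_mkseq /L; lia.
apply: acyclic; apply/andP; split.
  apply: cycle_mkseq => [|k kL].
    by rewrite f0 ha /f ltnNge leq_addr/=; congr h'; rewrite /L; lia.
  rewrite /f; case: ltnP => [k1|k1]; case: ltnP => [k2|k2].
  - by rewrite addnS ray_adj.
  - have Ek : k.+1 = L by apply/eqP; rewrite eqn_leq k1.
    rewrite Ek subnn subn0 -hb (_ : b = (a + k).+1) ?ray_adj//.
    by move: Ek; rewrite /L; lia.
  - by lia.
  - rewrite adj_sym (_ : (b - (k - L))%N = (b - (k.+1 - L)).+1) ?ray_adj//.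
    by move: kL k1; rewrite /L; lia.
apply/mkseq_uniqP => k l; rewrite !inE => kL lL; rewrite /f.
have hinj u v : h u = h v -> u = v by move=> uv; rewrite -(dh u) uv dh.
have hinj' u v : h' u = h' v -> u = v by move=> uv; rewrite -(dh' u) uv dh'.
case: ltnP => k1; case: ltnP => l1.
- by move=> /hinj/eqP; rewrite eqn_add2l => /eqP.
- move=> F; have F' := hh' _ _ F; case: (between (a + k)%N); last by rewrite {2}F'.
  by move: F' k1 l1 lL; rewrite /L; lia.
- move=> F; have F' := hh' _ _ (esym F); case: (between (a + l)%N); last by rewrite {2}F'.
  by move: F' k1 l1 kL; rewrite /L; lia.
- by move=> /hinj'; move: kL lL k1 l1; rewrite /L; lia.
Qed.

End Graph.

(** * The parent map *)

(** Everything that is used of the tree and of the end [omega] is the map sending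
a vertex to the next one on its ray to [omega], together with the level, which
increases by 1 along that map. *)
Lemma tree_parent {R : realType} {T : choiceType} (adj : rel T)
    (omega : set (nat -> T)) (xs : nat -> T) :
  is_tree adj -> boundary adj omega -> omega xs ->
  exists par : T -> T,
  [/\ forall x y, below omega x y <-> exists n, iter n par x = y,
      forall n x, gdist adj x (iter n par x) = n,
      forall x, successors (R := R) adj xs x = [set y | par y = x]
    & forall x, level (R := R) adj xs (par x) = level adj xs x + 1].
Proof.
move=> [sym _ conn acyc] [g0 gg0 <-]; set om := [set h | _] => omxs.
have dsym := gdist_sym sym conn.
have shift n h : om h -> om (fun k => h (n + k)%N).
  move=> [gh [a [b E]]]; split; first exact: geodesic_ray_shift.
  by exists (a + n)%N, b => k; rewrite -addnA E addnCA.
have equiv h h' : om h -> om h' -> ray_equiv h h'.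
  move=> [_ [a [b E]]] [_ [a' [b' E']]]; exists (b + a')%N, (b' + a)%N => k.
  by rewrite -addnA -E -addnA -E' addnCA.
have uniq h h' : om h -> om h' -> h 0%N = h' 0%N -> h =1 h'.
  by move=> oh oh' h00; apply: (ray_unique sym conn acyc); [case: oh|case: oh'| |apply: equiv].
have /choice[r rP] : forall x, exists h, om h /\ h 0%N = x.
  by move=> x; have [h [gh h0 eh]] := ray_from sym conn x gg0; exists h.
have omr x : om (r x) by case: (rP x).
have r0 x : r x 0%N = x by case: (rP x).
pose par x := r x 1%N.
have riter x n : r x n = iter n par x.
  elim: n => [|n IH] //; rewrite iterS -IH /par.
  rewrite -(uniq _ _ (shift n _ (omr x)) (omr (r x n))) ?addn1//.
  by rewrite addn0 r0.
have dist n x : gdist adj x (iter n par x) = n.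
  by have [gr _] := omr x; rewrite -riter -[in X in gdist adj X](r0 x) gr; lia.
have meet x : exists a b, forall k, iter (a + k) par x = xs (b + k)%N.
  have [a [b E]] := equiv _ _ (omr x) omxs.
  by exists a, b => k; rewrite -riter E.
have lev x a b : (forall k, iter (a + k) par x = xs (b + k)%N) ->
    level (R := R) adj xs x = b%:R - a%:R.
  move=> E; apply: lim_near_cst => //; exists b => // j /= bj.
  rewrite -(subnKC bj) -E dist !natrD; ring.
exists par; split=> //.
- move=> x y; split=> [[h [oh h0 [n hn]]]|[n <-]].
    by exists n; rewrite -riter -hn; apply: uniq => //; rewrite r0.
  by exists (r x); split=> //; exists n.
- move=> x; have levpar y : level (R := R) adj xs (par y) = level adj xs y + 1.
    have [a [b E]] := meet y; rewrite (lev y a b E) (lev (par y) a b.+1).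
      by rewrite -natr1; ring.
    by move=> k; rewrite -iterSr -addnS E addnS.
  apply/seteqP; split=> y /=; last first.
    move=> <-; split; last by rewrite levpar addrK.
    by rewrite dsym (dist 1%N).
  move=> [d1 ly]; have [a [b E]] := meet x; have [a' [b' E']] := meet y.
  have aa : a.+1 + b' = a' + b :> nat.
    have := ly; rewrite (lev x a b E) (lev y a' b' E') => /eqP.
    rewrite -(inj_eq (addIr (a%:R + a'%:R + 1))) => /eqP e.
    apply/eqP; rewrite -(eqr_nat R) !natrD -natr1; apply/eqP.
    by apply: etrans (_ : _ = b' %:R - a'%:R + (a%:R + a'%:R + 1)) _; [ring|rewrite e; ring].
  (* The levels force the walk from y through x along the ray of x to be as long
     as the ray of y up to the same far vertex; hence it is geodesic, and it is
     the ray of y. *)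
  have adjyx : adj y x by rewrite sym; exact: (adj_gdist1 conn).
  pose h k := if k is k'.+1 then r x k' else y.
  have gh : geodesic_ray adj h.
    apply: (geodesic_ray_steps sym conn) => [[|k]|N] /=.
    - by rewrite r0.
    - by apply: (ray_adj conn); case: (omr x).
    exists (a + (b' + N)).+1; first lia.
    rewrite /= riter E (_ : (b + (b' + N) = b' + (b + N))%N); last lia.
    by rewrite -E' dist; lia.
  have oh : om h.
    split=> //; have [_ [a1 [b1 E1]]] := omr x; exists a1, b1.+1 => k.
    by rewrite addSn /= E1.
  by rewrite /par (uniq _ _ (omr y) oh) ?r0//=.
- move=> x; have [a [b E]] := meet x; rewrite (lev x a b E) (lev (par x) a b.+1).
    by rewrite -natr1; ring.
  by move=> k; rewrite -iterSr -addnS E addnS.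
Qed.

(** * Sums of nonnegative families *)

Section Esum.
Context {R : realType} {T : choiceType}.
Implicit Types (A B : set T) (g h : T -> \bar R).
Local Open Scope ereal_scope.

Lemma esum_subset A B g : (forall z, 0 <= g z) -> A `<=` B ->
  \esum_(z in A) g z <= \esum_(z in B) g z.
Proof.
move=> g0 AB; apply: ereal_sup_le => _ [X [finX XA] <-].
by exists X => //; split=> //; exact: subset_trans AB.
Qed.

Lemma esum_setU_le A B g : (forall z, 0 <= g z) ->
  \esum_(z in A `|` B) g z <= \esum_(z in A) g z + \esum_(z in B) g z.
Proof.
move=> g0; rewrite (@esumID R T A (A `|` B)) //.
by apply: leeD; apply: esum_subset => // z [[]].
Qed.

Lemma esum_setU A B g : (forall z, 0 <= g z) -> A `&` B = set0 ->
  \esum_(z in A `|` B) g z = \esum_(z in A) g z + \esum_(z in B) g z.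
Proof.
move=> g0 AB; rewrite (@esumID R T A (A `|` B)) //.
have -> : (A `|` B) `&` A = A by rewrite setUK.
have -> // : (A `|` B) `&` ~` A = B.
apply/seteqP; split=> [z [[]]|z Bz] //; split; first by right.
by move=> Az; have : (A `&` B) z by []; rewrite AB.
Qed.

Lemma esumZl A g (r : R) : (forall z, 0 <= g z) -> (0 <= r)%R ->
  \esum_(z in A) (r%:E * g z) = r%:E * \esum_(z in A) g z.
Proof.
move=> g0 r0.
have le (k : R) (u : T -> \bar R) : (0 <= k)%R -> (forall z, 0 <= u z) ->
    \esum_(z in A) (k%:E * u z) <= k%:E * \esum_(z in A) u z.
  move=> k0 u0; apply: ge_ereal_sup => _ [X [finX XA] <-].
  rewrite -ge0_mule_fsumr// lee_wpmul2l ?lee_fin//.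
  by apply: ereal_sup_ubound; exists X.
apply/eqP; rewrite eq_le le//=.
have [->|rn0] := eqVneq r 0%R; first by rewrite mul0e esum_ge0// => z; rewrite mul0e.
have rgt0 : (0 < r)%R by rewrite lt_neqAle eq_sym rn0.
rewrite -lee_pdivlMl//; apply: le_trans (le r^-1%R _ _ _); last 2 first.
- by rewrite invr_ge0.
- by move=> z; rewrite mule_ge0.
apply: le_esum => z _; rewrite muleA -EFinM mulVf ?mul1e//.
Qed.

Lemma esum_le_seq A g (c : \bar R) : (forall z, 0 <= g z) ->
  (forall s : seq T, [set` s] `<=` A -> \esum_(z in [set` s]) g z <= c) ->
  \esum_(z in A) g z <= c.
Proof.
move=> g0 H; apply: ge_ereal_sup => _ [X [finX XA] <-].
rewrite -esum_fset//; move/finite_seqP: finX XA => [s ->]; exact: H.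
Qed.

Lemma esum_term A g z : (forall z, 0 <= g z) -> A z -> g z <= \esum_(y in A) g y.
Proof. by move=> g0 Az; rewrite -[leLHS](esum_set1 (g0 z)) esum_subset// => _ ->. Qed.

End Esum.

Lemma esum_swap {R : realType} {I J : choiceType} (a : I -> J -> \bar R) :
  (forall i j, (0 <= a i j)%E) ->
  \esum_(i in [set: I]) \esum_(j in [set: J]) a i j =
  \esum_(j in [set: J]) \esum_(i in [set: I]) a i j.
Proof.
move=> a0; rewrite !esum_esum//.
rewrite (reindex_esum ([set: J] `*`` (fun=> [set: I])) _ (fun x => (x.2, x.1)))//.
by split=> //= [[i1 i2] [j1 j2] /= _ _ [-> ->]|[i j] _] //=; exists (j, i).
Qed.

(** * Covering by the sets of highest level *)

Lemma seq_maximal {R : realType} {I : eqType} (lev : I -> R) (s : seq I) :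
  s != [::] -> exists2 i, i \in s & forall j, j \in s -> lev j <= lev i.
Proof.
elim: s => // i [|k s] IH _.
  by exists i; rewrite ?mem_head// => j; rewrite inE => /eqP->.
have [//|m ms mP] := IH _.
have [le|lt] := leP (lev m) (lev i).
  exists i; first exact: mem_head.
  by move=> j; rewrite inE => /predU1P[->//|/mP/le_trans]; apply.
exists m; first by rewrite inE ms orbT.
by move=> j; rewrite inE => /predU1P[->|/mP//]; apply: ltW.
Qed.

(** Greedy selection: a set of highest level swallows, through its envelope,
every set meeting it, and the remaining sets are disjoint from it, so that the
two sides of the inequality add up. *)
Lemma cover_highest_first {R : realType} {T : choiceType} {I : eqType}
    (lev : I -> R) (S env : I -> set T) (g h : T -> \bar R) (s : seq I) :
  (forall z, (0 <= g z)%E) -> (forall z, (0 <= h z)%E) ->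
  (forall i j, i \in s -> j \in s -> S i `&` S j !=set0 -> lev j <= lev i ->
     S j `<=` env i) ->
  (forall i, i \in s ->
     (\esum_(y in env i) h y <= \esum_(y in S i) g y)%E) ->
  (\esum_(y in \bigcup_(i in [set` s]) S i) h y <=
   \esum_(y in \bigcup_(i in [set` s]) S i) g y)%E.
Proof.
move=> g0 h0.
have [n] := ubnP (size s); elim: n s => // n IH s sn cov est.
have [->|s0] := eqVneq s [::].
  by rewrite set_nil bigcup_set0 !esum_set0.
have [i si imax] := seq_maximal lev s0.
pose P j := `[< S i `&` S j = set0 >].
set s2 := [seq j <- s | P j].
have ss2 j : j \in s2 -> j \in s by rewrite mem_filter => /andP[].
set U2 := \bigcup_(j in [set` s2]) S j.
(* An empty S i would be disjoint from itself and i would stay in s2; such an i is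
   removed by hand, so that the recursion is on a shorter list. *)
have [Si0|Sin0] := eqVneq (S i) set0.
  have E : \bigcup_(j in [set` s]) S j = \bigcup_(j in [set` rem i s]) S j.
    apply/seteqP; split=> z [j /= js Sj]; last first.
      by exists j => //=; exact: mem_rem js.
    exists j => //=; have ji : j != i.
      by apply/eqP => ji; move: Sj; rewrite ji Si0.
    by move: js; rewrite (perm_mem (perm_to_rem si)) inE (negbTE ji).
  rewrite E; apply: IH.
  - by rewrite size_rem//; case: (s) s0 sn.
  - by move=> j k /mem_rem js /mem_rem ks; exact: cov.
  - by move=> j /mem_rem; exact: est.
have s2n : (size s2 < n)%N.
  rewrite -ltnS; apply: leq_trans sn; rewrite ltnS size_filter ltn_neqAle count_size andbT.
  rewrite -all_count; apply/negP => /allP/(_ _ si)/asboolP.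
  by rewrite setIid => /eqP; exact/negP.
have disj : S i `&` U2 = set0.
  apply/seteqP; split=> // z [Siz [j /=]]; rewrite mem_filter => /andP[/asboolP E _] Sj.
  by have : (S i `&` S j) z by []; rewrite E.
have U2U : S i `|` U2 `<=` \bigcup_(j in [set` s]) S j.
  move=> z [Sz|[j /= /ss2 js Sj]]; [by exists i|by exists j].
have UU : \bigcup_(j in [set` s]) S j `<=` env i `|` U2.
  move=> z [j /= js Sj]; have [Pj|/asboolP Pj] := boolP (P j).
    by right; exists j => //=; rewrite mem_filter Pj.
  by left; apply: (cov i j) => //; [exact/set0P/eqP|exact: imax].
apply: le_trans (esum_subset h0 UU) _; apply: le_trans (esum_setU_le _ _ h0) _.
apply: le_trans (esum_subset g0 U2U); rewrite esum_setU//; apply: leeD.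
  exact: est.
by apply: IH => // [j k /ss2 ? /ss2 ?|j /ss2]; [exact: cov|exact: est].
Qed.

(** * The weak type inequality *)

Section WeakType.
Context {R : realType} {T : choiceType}.
Local Open Scope ereal_scope.

Lemma mass_ge0 (m : T -> R) (E : set T) : (forall z, 0 < m z)%R -> 0 <= mass m E.
Proof. by move=> m0; apply: esum_ge0 => z _; rewrite lee_fin ltW. Qed.

Lemma massZ (m : T -> R) (E : set T) (t : R) : (forall z, 0 < m z)%R -> (0 <= t)%R ->
  \esum_(y in E) (t%:E * (m y)%:E) = t%:E * mass m E.
Proof. by move=> m0 t0; rewrite esumZl// => z; rewrite lee_fin ltW. Qed.

Lemma mass_gt0 (m : T -> R) (E : set T) z : (forall z, 0 < m z)%R -> E z ->
  0 < mass m E.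
Proof.
move=> m0 Ez; apply: lt_le_trans (_ : (m z)%:E <= _); first by rewrite lte_fin.
by apply: (@esum_term _ _ E (fun y => (m y)%:E)) => // y; rewrite lee_fin ltW.
Qed.

(** This is what the covering argument gives, and all that is used of the
geometry afterwards. The function [g] is a density with respect to the counting
measure, so that the same statement serves for averages with respect to [m] and,
under the $A_1$ condition, for averages with respect to another measure. *)
Definition covering_bound (fam : set (set T)) (m : T -> R) (K : R) : Prop :=
  forall (g : T -> \bar R) (t : R) (B : set T),
    (forall z, 0 <= g z) -> (0 < t)%R ->
    (forall z, B z -> exists E, [/\ fam E, E z &
        t%:E * mass m E <= \esum_(y in E) g y]) ->
    t%:E * mass m B <= K%:E * \esum_(y in [set: T]) g y.

Lemma covering_bound_indexed (I : Type) (D : set I) (lev : I -> R)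
    (S env : I -> set T) (m : T -> R) (K : R) :
  (forall z, 0 < m z)%R -> (0 <= K)%R ->
  (forall i j, D i -> D j -> S i `&` S j !=set0 -> (lev j <= lev i)%R ->
     S j `<=` env i) ->
  (forall i, D i -> mass m (env i) <= K%:E * mass m (S i)) ->
  covering_bound (S @` D) m K.
Proof.
move=> m0 K0 cov dbl g t B g0 t0 HB.
have tm0 z : 0 <= t%:E * (m z)%:E by rewrite -EFinM lee_fin mulr_ge0 ?ltW.
have Kg0 z : 0 <= K%:E * g z by rewrite mule_ge0.
have t0w := ltW t0.
rewrite -massZ// -esumZl//; apply: esum_le_seq => // s sB.
have [B0|/set0P[z0 Bz0]] := eqVneq B set0.
  move: sB; rewrite B0 subset0 => ->.
  by rewrite esum_set0 esum_ge0.
have /choice[sel selP] : forall z, exists i, B z ->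
    [/\ D i, S i z & t%:E * mass m (S i) <= \esum_(y in S i) g y].
  move=> z; have [Bz|nBz] := pselect (B z); last first.
    by have [_ [[i _ _] _ _]] := HB _ Bz0; exists i.
  by have [_ [[i Di <-] Sz le]] := HB _ Bz; exists i.
apply: le_trans (_ : \esum_(y in \bigcup_(z in [set` s]) S (sel z)) (t%:E * (m y)%:E) <= _).
  by apply: esum_subset => // z zs; exists z => //; case: (selP z (sB _ zs)).
apply: le_trans (esum_subset Kg0 (@subsetT _ _)).
apply: (@cover_highest_first _ _ _ (lev \o sel) (S \o sel) (env \o sel)) => //=.
  move=> i j /sB Bi /sB Bj; apply: cov; first by case: (selP i Bi).
  by case: (selP j Bj).
move=> i /sB/selP[Di _ le]; rewrite massZ// esumZl//.
apply: (@le_trans _ _ (t%:E * (K%:E * mass m (S (sel i))))).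
  by rewrite lee_wpmul2l ?dbl// lee_fin ltW.
by rewrite muleCA lee_wpmul2l.
Qed.

End WeakType.

(** * The strong type inequality *)

(** The terms grow geometrically, so the sum is comparable to its last term. The
bound by [(e * 2 ^+ n) `^ q], proved alongside, is what lets the induction add
the next term. *)
Lemma geometric_sum_le {R : realType} (q e s : R) (n : nat) :
  0 < q -> 0 <= e -> 0 <= s ->
  \sum_(k < n | e * 2 ^+ k < s) (e * 2 ^+ k) `^ q <= (2 * s) `^ q / (2 `^ q - 1).
Proof.
move=> q0 e0 s0.
have r1 : 1 < 2 `^ q :> R.
  have E : 1 `^ q = 1 :> R by rewrite powR1.
  by rewrite -[ltLHS]E gt0_ltr_powR ?nnegrE ?ltr1n.
rewrite ler_pdivlMr ?subr_gt0//.
suff [] : (\sum_(k < n | e * 2 ^+ k < s) (e * 2 ^+ k) `^ q) * (2 `^ q - 1) <=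
    (e * 2 ^+ n) `^ q /\
    (\sum_(k < n | e * 2 ^+ k < s) (e * 2 ^+ k) `^ q) * (2 `^ q - 1) <=
    (2 * s) `^ q by [].
have pos k : 0 <= e * 2 ^+ k by rewrite mulr_ge0// exprn_ge0.
have step k : (e * 2 ^+ k.+1) `^ q = 2 `^ q * (e * 2 ^+ k) `^ q.
  by rewrite -powRM// exprS mulrCA.
elim: n => [|n [IH1 IH2]]; first by rewrite big_ord0 mul0r !powR_ge0.
rewrite big_mkcond big_ord_recr/= -big_mkcond/=.
have [lt|ge] := ltP (e * 2 ^+ n) s; last first.
  rewrite addr0; split => //; apply: le_trans IH1 _.
  by rewrite step ler_peMl ?powR_ge0// ltW.
have H : (\sum_(k < n | e * 2 ^+ k < s) (e * 2 ^+ k) `^ q + (e * 2 ^+ n) `^ q) *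
    (2 `^ q - 1) <= (e * 2 ^+ n.+1) `^ q.
  rewrite mulrDl step; apply: le_trans (lerD IH1 (lexx _)) _.
  by rewrite -[X in X + _]mulr1 -mulrDr addrCA subrr addr0 mulrC.
split=> //; apply: le_trans H _.
by rewrite ge0_ler_powR ?nnegrE ?(ltW q0) ?mulr_ge0// exprS mulrCA ler_pM2l// ltW.
Qed.

Lemma exists_pow2_ge {R : realType} (e y : R) : 0 < e ->
  exists k : nat, y <= e * 2 ^+ k.
Proof.
move=> e0; exists (Num.bound (y / e)).
rewrite -ler_pdivrMl// mulrC; apply: le_trans (ler_norm _) _.
rewrite ltW//; apply: lt_le_trans (archi_boundP (normr_ge0 _)) _.
rewrite (_ : Num.bound _ = Num.bound (y / e)); last by rewrite /Num.bound normr_id.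
by rewrite -natrX ler_nat ltnW// ltn_expl.
Qed.

Section StrongType.
Context {R : realType} {T : choiceType}.
Local Open Scope ereal_scope.

Definition weighted_maximal (fam : set (set T)) (m : T -> R) (g : T -> \bar R)
    (z : T) : \bar R :=
  ereal_sup [set (\esum_(y in E) (g y * (m y)%:E)) / mass m E
            | E in fam `&` [set E | E z]].

Lemma esum_nat_le (a : nat -> \bar R) (c : \bar R) : (forall k, 0 <= a k) ->
  (forall n, \sum_(k < n) a k <= c) -> \esum_(k in [set: nat]) a k <= c.
Proof.
move=> a0 H; rewrite -nneseries_esumT//.
apply: lime_le; first exact: is_cvg_nneseries.
by apply: nearW => n; rewrite big_mkord.
Qed.

Lemma divide_mass (m : T -> R) (E : set T) z : (forall z, 0 < m z)%R -> E z ->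
  mass m E < +oo -> exists c : R, [/\ (0 < c)%R, mass m E = c%:E &
    (mass m E)^-1 = (c^-1)%:E].
Proof.
move=> m0 Ez fin; have c0 := mass_gt0 m0 Ez.
have finE : mass m E \is a fin_num by rewrite ge0_fin_numE// ltW.
have pos : (0 < fine (mass m E))%R by rewrite -lte_fin fineK.
exists (fine (mass m E)); split; rewrite ?fineK//.
by rewrite -[in LHS](fineK finE) inver gt_eqF.
Qed.

Variables (fam : set (set T)) (m : T -> R) (K : R).
Hypothesis m_gt0 : (forall z, 0 < m z)%R.
Hypothesis m_fin : forall E, fam E -> mass m E < +oo.
Hypothesis m_cov : covering_bound fam m K.

Lemma weighted_maximal_ge0 g z : (forall y, 0 <= g y) ->
  fam [set z] -> 0 <= weighted_maximal fam m g z.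
Proof.
move=> g0 famz.
apply: (@le_ereal_sup_tmp _ _ _); exists ((\esum_(y in [set z]) (g y * (m y)%:E)) / mass m [set z]).
  by exists [set z].
rewrite mule_ge0 ?inve_ge0 ?mass_ge0//; apply: esum_ge0 => y _.
by rewrite mule_ge0// lee_fin ltW.
Qed.

(** The part of [g] below [t / 2] contributes at most [t / 2] to an average, so
only its larger values count where the maximal function exceeds [t]. *)
Lemma weighted_maximal_weak (g : T -> \bar R) (t : R) :
  (forall y, 0 <= g y) -> (0 < t)%R ->
  (t / 2)%:E * mass m [set z | t%:E < weighted_maximal fam m g z] <=
  K%:E * \esum_(y in [set: T]) (if (t / 2)%:E < g y then g y * (m y)%:E else 0).
Proof.
move=> g0 t0; have t2 : (0 < t / 2)%R by rewrite divr_gt0.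
have mE0 y : 0 <= (m y)%:E by rewrite lee_fin ltW.
have big0 y : 0 <= if (t / 2)%:E < g y then g y * (m y)%:E else 0.
  by case: ifP => // _; rewrite mule_ge0.
apply: m_cov => // z /= /ereal_sup_gt[_ [E [famE Ez] <-]].
have [c [c0 massE ->]] := divide_mass m_gt0 Ez (m_fin famE).
rewrite lte_pdivlMr// => lt; exists E; split=> //; rewrite massE.
have : \esum_(y in E) (g y * (m y)%:E) <=
    (\esum_(y in E) if (t / 2)%:E < g y then g y * (m y)%:E else 0) + (t / 2)%:E * c%:E.
  rewrite -massE -massZ ?(ltW t2)// -esumD//; last first.
    by move=> y _; rewrite mule_ge0// lee_fin ltW.
  apply: le_esum => y _; case: ltP => [_|le].
    by rewrite leeDl// mule_ge0// lee_fin ltW.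
  by rewrite add0e lee_wpmul2r.
move=> /(le_trans (ltW lt)); rewrite -!EFinM -leeBlDr//.
by rewrite -EFinB -mulrBl {1}(splitr t) addrK.
Qed.

(** The layer just below [y] alone suffices; for infinite [y] all layers are
present and their heights are unbounded. *)
Lemma powere_le_layers (e q : R) (y : \bar R) : (0 < e)%R -> (0 < q)%R ->
  e%:E < y ->
  y `^ q <= \esum_(k in [set: nat])
    (if (e * 2 ^+ k)%:E < y then ((2 * (e * 2 ^+ k)) `^ q)%:E else 0).
Proof.
move=> e0 q0 ey; set L := (X in _ <= X).
have layer r : (e < r)%R -> r%:E <= y -> r%:E `^ q <= L.
  move=> er ry; have ek : exists k, (r <= e * 2 ^+ k)%R by exact: exists_pow2_ge.
  case: (ex_minnP ek) => -[|k] rk kmin; first by rewrite expr0 mulr1 leNgt er in rk.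
  have lt : (e * 2 ^+ k < r)%R.
    by rewrite ltNge; apply/negP => /kmin; rewrite ltnn.
  apply: le_trans (_ : (if (e * 2 ^+ k)%:E < y then ((2 * (e * 2 ^+ k)) `^ q)%:E else 0) <= _).
    rewrite (lt_le_trans _ ry) ?lte_fin// poweR_EFin lee_fin.
    have pk : (0 <= e * 2 ^+ k)%R by rewrite mulr_ge0 ?exprn_ge0// ltW.
    have r0 := lt_trans e0 er.
    rewrite ge0_ler_powR ?(ltW q0) ?nnegrE ?(ltW r0) ?mulr_ge0 ?(ltW e0)//.
    by rewrite mulrCA -exprS.
  apply: (@esum_term _ _ _ (fun k => if (e * 2 ^+ k)%:E < y then
    ((2 * (e * 2 ^+ k)) `^ q)%:E else 0)) => // j.
  by case: ifP => // _; rewrite lee_fin powR_ge0.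
case: y ey @L layer => [r| |] // ey L layer; first by apply: layer; rewrite ?lexx -?lte_fin.
suff -> : L = +oo by rewrite leey.
apply: eq_infty => r.
pose s := Num.max (e * 2)%R (`|r| `^ q^-1)%R.
apply: le_trans (layer s _ _); rewrite ?leey//; last by rewrite lt_max ltr_pMr// ltr1n.
rewrite poweR_EFin lee_fin; apply: le_trans (ler_norm _) _.
rewrite -[leLHS]powRr1// -(mulVf (lt0r_neq0 q0)) powRrM.
by rewrite ge0_ler_powR ?(ltW q0) ?nnegrE ?powR_ge0// le_max ?lexx ?orbT// powR_ge0 orbT.
Qed.

Lemma seq_positive_lower_bound (M : T -> \bar R) (s : seq T) :
  exists2 e : R, (0 < e)%R & forall z, z \in s -> 0 < M z -> e%:E < M z.
Proof.
elim: s => [|z s [e e0 IH]]; first by exists 1%R.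
have [d d0 dz] : exists2 d : R, (0 < d)%R & (0 < M z -> d%:E < M z).
  case: (M z) => [r| |]; [|by exists 1%R; rewrite ?ltry|by exists 1%R].
  have [r0|r0] := ltP 0%R r; last first.
    by exists 1%R => //; rewrite lte_fin ltNge r0.
  exists (r / 2)%R; first by rewrite divr_gt0.
  by move=> _; rewrite lte_fin ltr_pdivrMr// ltr_pMr// ltr1n.
exists (Num.min e d); first by rewrite lt_min e0.
move=> y; rewrite inE => /predU1P[->|ys] M0.
  by apply: le_lt_trans (dz M0); rewrite lee_fin ge_min lexx orbT.
by apply: le_lt_trans (IH y ys M0); rewrite lee_fin ge_min lexx.
Qed.

(** The sum over the layers, carried out at a single point. *)
Lemma layer_sum_le (q e : R) (z : \bar R) : (1 < q)%R -> (0 < e)%R -> 0 <= z ->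
  \esum_(k in [set: nat]) (((e * 2 ^+ k) `^ (q - 1))%:E *
     (if (e * 2 ^+ k / 2)%:E < z then z else 0)) <=
  (4 `^ (q - 1) / (2 `^ (q - 1) - 1))%:E * z `^ q.
Proof.
move=> q1 e0; have q10 : (0 < q - 1)%R by rewrite subr_gt0.
have q0 : (0 < q)%R by rewrite (lt_trans _ q1).
have r1 : (1 < 2 `^ (q - 1) :> R)%R.
  have E : (1 `^ (q - 1) = 1 :> R)%R by rewrite powR1.
  by rewrite -[ltLHS]E gt0_ltr_powR ?nnegrE ?ltr1n.
have C0 : (0 < 4 `^ (q - 1) / (2 `^ (q - 1) - 1) :> R)%R.
  by rewrite divr_gt0 ?powR_gt0 ?subr_gt0.
case: z => [r| |] //; last first.
  by move=> _; rewrite poweRyr ?gt_eqF// gt0_muley ?lte_fin// leey.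
rewrite lee_fin => r0; apply: esum_nat_le => [k|n].
  by rewrite mule_ge0 ?lee_fin ?powR_ge0//; case: ifP; rewrite ?lee_fin.
rewrite poweR_EFin -EFinM.
rewrite (eq_bigr (fun k : 'I_n => (if (e * 2 ^+ k < 2 * r)%R then
    ((e * 2 ^+ k) `^ (q - 1))%R else 0%R)%:E * r%:E)); last first.
  move=> k _; rewrite lte_fin ltr_pdivrMr// (mulrC r).
  by case: ifP => _; rewrite ?mule0 ?mul0e.
rewrite -ge0_sume_distrl; last by move=> k _; case: ifP; rewrite lee_fin ?powR_ge0.
rewrite sumEFin -big_mkcond/= -EFinM lee_fin.
have := @geometric_sum_le R (q - 1) e (2 * r) n q10 (ltW e0).
rewrite mulr_ge0// mulrA -natrM powRM// => /(_ isT) H.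
apply: le_trans (ler_wpM2r r0 H) _.
by rewrite -(mulr_powRB1 r0 q0) (mulrC r) mulrA [X in (_ <= X * r)%R]mulrAC.
Qed.

(** Marcinkiewicz interpolation between the weak type inequality and the trivial
bound on bounded functions, with the layers taken along the scales
[e * 2 ^+ k] only; letting [e] tend to 0 is replaced by the choice of [e] below
the finitely many positive values that matter. *)
Lemma weighted_maximal_strong (q : R) : (0 < K)%R -> (1 < q)%R ->
  exists2 C : R, (0 < C)%R & forall g : T -> \bar R, (forall y, 0 <= g y) ->
    (forall z, 0 <= weighted_maximal fam m g z) ->
    \esum_(z in [set: T]) (weighted_maximal fam m g z `^ q * (m z)%:E) <=
    C%:E * \esum_(z in [set: T]) (g z `^ q * (m z)%:E).
Proof.
move=> K0 q1; have q0 : (0 < q)%R by rewrite (lt_trans _ q1).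
have r1 : (1 < 2 `^ (q - 1) :> R)%R.
  have E : (1 `^ (q - 1) = 1 :> R)%R by rewrite powR1.
  by rewrite -[ltLHS]E gt0_ltr_powR ?nnegrE ?ltr1n ?subr_gt0.
pose A := (2 `^ q * 2 * K)%R; pose c := (4 `^ (q - 1) / (2 `^ (q - 1) - 1) : R)%R.
have A0 : (0 < A)%R by rewrite !mulr_gt0 ?powR_gt0.
have c0 : (0 < c)%R by rewrite divr_gt0 ?powR_gt0 ?subr_gt0.
exists (A * c)%R; first by rewrite mulr_gt0.
move=> g g0; set M := weighted_maximal fam m g => M0.
have mE0 y : 0 <= (m y)%:E by rewrite lee_fin ltW.
apply: esum_le_seq => [z|s _]; first by rewrite mule_ge0// poweR_ge0.
have [e e0 eP] := seq_positive_lower_bound M s.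
pose t k := (e * 2 ^+ k)%R.
have t0 k : (0 < t k)%R by rewrite mulr_gt0 ?exprn_gt0.
pose L k z := if (t k)%:E < M z then ((2 * t k) `^ q)%:E else 0.
have L0 k z : 0 <= L k z by rewrite /L; case: ifP; rewrite ?lee_fin ?powR_ge0.
have Lm0 k z : 0 <= L k z * (m z)%:E by rewrite mule_ge0.
pose H k z := if (t k / 2)%:E < g z then g z * (m z)%:E else 0.
have H0 k z : 0 <= H k z by rewrite /H; case: ifP => // _; rewrite mule_ge0.
have p0 k : 0 <= ((t k) `^ (q - 1))%:E by rewrite lee_fin powR_ge0.
apply: (@le_trans _ _ (\esum_(z in [set: T]) \esum_(k in [set: nat]) (L k z * (m z)%:E))).
  apply: le_trans (esum_subset _ (@subsetT _ [set` s])); last first.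
    by move=> z; apply: esum_ge0 => k _.
  apply: le_esum => z /= zs.
  have -> : \esum_(k in [set: nat]) (L k z * (m z)%:E) =
      (m z)%:E * \esum_(k in [set: nat]) L k z.
    rewrite -esumZl ?(ltW (m_gt0 z))//.
    by apply: eq_esum => k _; rewrite muleC.
  rewrite muleC lee_wpmul2l//.
  have [Mz|] := ltP 0 (M z); first exact: powere_le_layers (eP z zs Mz).
  move=> Mz; have -> : M z = 0 by apply/eqP; rewrite eq_le Mz M0.
  by rewrite poweR0r ?gt_eqF// esum_ge0.
rewrite esum_swap//.
apply: (@le_trans _ _ (\esum_(k in [set: nat]) \esum_(z in [set: T])
    (A%:E * (((t k) `^ (q - 1))%:E * H k z)))).
  apply: le_esum => k _; rewrite esumZl ?(ltW A0)//; last by move=> z; rewrite mule_ge0.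
  rewrite esumZl ?powR_ge0//.
  have -> : \esum_(z in [set: T]) (L k z * (m z)%:E) =
      (2 `^ q * 2 * t k `^ (q - 1))%:E * ((t k / 2)%:E * mass m [set z | (t k)%:E < M z]).
    rewrite muleA -EFinM.
    have -> : (2 `^ q * 2 * t k `^ (q - 1) * (t k / 2) = (2 * t k) `^ q)%R.
      rewrite powRM ?(ltW (t0 k))// -(mulr_powRB1 (ltW (t0 k)) q0).
      by field.
    rewrite /mass -esumZl ?powR_ge0// esum_mkcond [RHS]esum_mkcond.
    apply: eq_esum => z _; rewrite !in_setT /L.
    case: ifPn => lt; first by rewrite mem_set.
    by rewrite memNset ?mul0e//=; apply/negP.
  apply: le_trans (lee_wpmul2l _ (weighted_maximal_weak g0 (t0 k))) _.
    by rewrite lee_fin !mulr_ge0 ?powR_ge0.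
  by rewrite !muleA -!EFinM /A (mulrAC _ K).
rewrite esum_swap; last by move=> k z; rewrite !mule_ge0// lee_fin ltW.
have Ac0 : (0 <= A * c)%R by rewrite ltW// mulr_gt0.
rewrite -esumZl//; last by move=> z; rewrite mule_ge0 ?poweR_ge0.
apply: le_esum => z _.
rewrite esumZl ?(ltW A0)//; last by move=> k; rewrite mule_ge0.
rewrite [X in _ <= X * _](EFinM A c) -[X in _ <= X]muleA lee_wpmul2l ?lee_fin ?(ltW A0)//.
have -> : \esum_(k in [set: nat]) (((t k) `^ (q - 1))%:E * H k z) =
    (m z)%:E * \esum_(k in [set: nat]) (((t k) `^ (q - 1))%:E *
      (if (t k / 2)%:E < g z then g z else 0)).
  rewrite -esumZl ?(ltW (m_gt0 z))//; last first.
    by move=> k; rewrite mule_ge0//; case: ifP.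
  apply: eq_esum => k _; rewrite /H muleCA; case: ifP => _; last by rewrite !mule0.
  by rewrite (muleC (g z)).
by rewrite [X in _ <= X]muleA [X in _ <= X]muleC lee_wpmul2l// layer_sum_le.
Qed.

End StrongType.

(** * Bands below a vertex *)

Section Bands.
Context {R : realType} {T : choiceType}.
Variables (par : T -> T) (lev : T -> R).
Hypothesis lev_par : forall x, lev (par x) = lev x + 1.

Definition band (h1 h2 : nat) (x : T) : set T :=
  [set y | exists n, (h1 <= n < h2)%N /\ iter n par y = x].

Lemma lev_iter n y : lev (iter n par y) = lev y + n%:R.
Proof. by elim: n => [|n IH]; rewrite ?addr0//= lev_par IH -natr1 addrA. Qed.

Lemma iter_par_inj m n y : iter m par y = iter n par y -> m = n.
Proof.
move=> /(congr1 lev); rewrite !lev_iter => /addrI/eqP.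
by rewrite eqr_nat => /eqP.
Qed.

Lemma band_singleton x : band 0 1 x = [set x].
Proof.
apply/seteqP; split=> [y [[|n] [//]] _ <-|y ->] //; by exists 0%N.
Qed.

Lemma band_sub a b a' b' x : (a' <= a)%N -> (b <= b')%N ->
  band a b x `<=` band a' b' x.
Proof.
move=> aa bb y [n [/andP[an nb] <-]]; exists n; split=> //.
by rewrite (leq_trans aa an) (leq_trans nb bb).
Qed.

Section Flow.
Variable mu : T -> R.
Hypothesis mu_gt0 : forall x, 0 < mu x.
Hypothesis mu_flow : forall x,
  (mu x)%:E = \esum_(y in [set y | par y = x]) (mu y)%:E.

(** The flow condition iterated over [n] generations. *)
Lemma mass_generation n x : mass mu [set y | iter n par y = x] = (mu x)%:E.
Proof.
have mu0 z : (0 <= (mu z)%:E)%E by rewrite lee_fin ltW.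
elim: n x => [|n IH] x.
  by rewrite /mass (_ : [set y | _] = [set x]) ?esum_set1.
rewrite -IH /mass [RHS](eq_esum (fun z _ => mu_flow z)) [RHS]esum_esum//.
rewrite [RHS](reindex_esum [set y | iter n.+1 par y = x] _ (fun y => (par y, y)))//.
split=> [y /=|y z _ _ [_ ->]|[z y] /= [zx yz]] //; first by rewrite -iterSr.
by exists y; rewrite /= ?yz// -iterS iterSr yz.
Qed.

Lemma mass_band h k x : mass mu (band h (h + k) x) = (k%:R * mu x)%:E.
Proof.
have mu0 z : (0 <= (mu z)%:E)%E by rewrite lee_fin ltW.
elim: k => [|k IH].
  rewrite addn0 mul0r /mass (_ : band _ _ _ = set0) ?esum_set0//.
  by apply/seteqP; split=> // y [n [/andP[hn nh] _]]; move: (leq_trans nh hn); rewrite ltnn.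
rewrite (_ : band _ _ _ = band h (h + k) x `|` [set y | iter (h + k) par y = x]).
  rewrite /mass esum_setU//.
    have := IH; have := mass_generation (h + k) x; rewrite /mass => -> ->.
    by rewrite -EFinD -natr1 mulrDl mul1r.
  apply/seteqP; split=> // y [[n [/andP[_ nh] yx]] /= yx'].
  by have := @iter_par_inj n (h + k) y; rewrite yx yx' => /(_ erefl) E; rewrite E ltnn in nh.
apply/seteqP; split=> y.
  move=> [n [/andP[hn]]]; rewrite addnS ltnS leq_eqVlt => /predU1P[->|nh]; first by right.
  by left; exists n; rewrite hn nh.
move=> [[n [/andP[hn nh] yx]]|yx].
  by exists n; split=> //; rewrite hn addnS ltnW.
by exists (h + k)%N; split=> //; rewrite leq_addr addnS /=.
Qed.

End Flow.

Section Envelope.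
Variable beta : R.
Hypothesis beta_ge4 : 4 <= beta.
Variable N : nat.
Hypothesis beta_le : beta <= 2 ^+ N.

Lemma admissible_bounds h1 h2 : admissible beta h1 h2 ->
  [/\ (0 < h1)%N, (2 * h1 <= h2)%N & (h2 <= 2 ^ N * h1)%N].
Proof.
move=> [h10 _ lo hi]; have h1R : 0 < h1%:R :> R by rewrite ltr0n.
split=> //.
  by move: lo; rewrite ler_pdivlMr// -natrM ler_nat.
move: (le_trans hi beta_le).
by rewrite ler_pdivrMr// -natrX -natrM ler_nat.
Qed.

Lemma admissible_nat a b : (0 < a)%N -> (2 * a <= b)%N -> (b <= 4 * a)%N ->
  admissible beta a b.
Proof.
move=> a0 lo hi; have aR : 0 < a%:R :> R by rewrite ltr0n.
split=> //; first by lia.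
  by rewrite ler_pdivlMr// -natrM ler_nat.
by rewrite ler_pdivrMr//; apply: le_trans (ler_wpM2r (ltW aR) beta_ge4); rewrite -natrM ler_nat.
Qed.

(** Singletons are encoded as the bands of heights 0 and 1, so that a single
indexed family covers all the sets in the supremum. *)
Definition indices : set (T * (nat * nat)) :=
  [set i | i.2 = (0%N, 1%N) \/ admissible beta i.2.1 i.2.2].

Definition index_band (i : T * (nat * nat)) : set T := band i.2.1 i.2.2 i.1.

(** A band meeting the given one and having no higher root shares with it a vertex
at some depth below each root. Admissibility bounds the depths in the second band
by [2 ^ N] times this one and vice versa, and passing to the higher root adds the
same number of generations to both; this gives the two factors [2 ^ N]. A
singleton meets no band with such a root other than itself. *)
Definition envelope (i : T * (nat * nat)) : set T :=
  [set y | if i.2.1 == 0%N then y = i.1 else exists n,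
    [/\ (0 < n)%N, (i.2.1 <= 2 ^ N * n)%N, (n < 2 ^ N * i.2.2)%N
      & iter n par y = i.1]].

Lemma meeting_sub_envelope i j : indices i -> indices j ->
  index_band i `&` index_band j !=set0 -> lev j.1 <= lev i.1 ->
  index_band j `<=` envelope i.
Proof.
case: i j => [x1 [h1 h2]] [x2 [k1 k2]] /= Di Dj.
move=> [z [[n [/andP[h1n nh2] zx1]] [m [/andP[k1m mk2] zx2]]]] lev21.
move=> y [l [/andP[k1l lk2] yx2]]; rewrite /= in h1n nh2 zx1 k1m mk2 zx2 k1l lk2 yx2 *.
have mn : (m <= n)%N.
  by move: lev21; rewrite -zx1 -zx2 !lev_iter lerD2l ler_nat.
have yx1 : iter (n - m + l) par y = x1.
  by rewrite iterD yx2 -zx2 -iterD subnK.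
have [h10|h10] := eqVneq h1 0%N.
  have [n0 h21] : n = 0%N /\ h2 = 1%N.
    case: Di => [/= [_ h21]|/admissible_bounds /= []]; last by rewrite h10.
    by split=> //; move: nh2; rewrite h21; case: (n).
  have l0 : l = 0%N.
    case: Dj => [/= [_ k21]|/admissible_bounds /= []].
      by move: lk2; rewrite k21; case: (l).
    by move=> k10 _ _; move: mn k1m; rewrite n0; lia.
  by rewrite /= ?h10 /=; move: yx1; rewrite n0 l0.
rewrite /envelope /= (negbTE h10); exists (n - m + l)%N.
have N0 : (0 < 2 ^ N)%N by rewrite expn_gt0.
case: Dj => [/= [k10 k21]|/admissible_bounds /= [k10 k1k2 k2N]].
  by subst k1 k2; split=> //; nia.
by split=> //; nia.
Qed.

Section Doubling.
Variables (nu : T -> R) (K0 : R).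
Hypothesis nu_gt0 : forall x, 0 < nu x.
Hypothesis K0_ge1 : 1 <= K0.
Hypothesis nu_doubling : forall x a b a' b',
  admissible beta a b -> admissible beta a' b' -> (a' <= a)%N -> (b <= b')%N ->
  (mass nu (band a' b' x) <= K0%:E * mass nu (band a b x))%E.

Let nu0 z : (0 <= (nu z)%:E)%E. Proof. by rewrite lee_fin ltW. Qed.

Let K00 : 0 <= K0. Proof. exact: le_trans K0_ge1. Qed.

Let dyadic x j := band (2 ^ j) (2 ^ j.+1) x.

Let mass_band_sub a b a' b' x : (a' <= a)%N -> (b <= b')%N ->
  (mass nu (band a b x) <= mass nu (band a' b' x))%E.
Proof. by move=> aa bb; apply: esum_subset => //; exact: band_sub. Qed.

Let dyadic_chain x j k :
  (mass nu (dyadic x (j + k)) <= (K0 ^+ k)%:E * mass nu (dyadic x j))%E /\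
  (mass nu (dyadic x j) <= (K0 ^+ k)%:E * mass nu (dyadic x (j + k)))%E.
Proof.
have pos i : (0 < 2 ^ i)%N by rewrite expn_gt0.
have adm2 i : admissible beta (2 ^ i) (2 ^ i.+1) by apply: admissible_nat; rewrite ?expnS; lia.
have adm4 i : admissible beta (2 ^ i) (2 ^ i.+2) by apply: admissible_nat; rewrite ?expnS; lia.
have up i : (mass nu (dyadic x i.+1) <= K0%:E * mass nu (dyadic x i))%E.
  apply: le_trans (nu_doubling x (adm2 i) (adm4 i) _ _); rewrite ?leq_exp2l//.
  by apply: mass_band_sub; rewrite ?leq_exp2l.
have down i : (mass nu (dyadic x i) <= K0%:E * mass nu (dyadic x i.+1))%E.
  apply: le_trans (nu_doubling x (adm2 i.+1) (adm4 i) _ _); rewrite ?leq_exp2l//.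
  by apply: mass_band_sub; rewrite ?leq_exp2l.
elim: k => [|k [IH1 IH2]]; first by rewrite addn0 expr0 !mul1e.
rewrite addnS; split.
  by apply: le_trans (up _) _; rewrite exprS EFinM -muleA lee_wpmul2l.
apply: le_trans IH2 _; rewrite exprSr EFinM -muleA lee_wpmul2l//.
by rewrite lee_fin exprn_ge0.
Qed.

Lemma mass_finite_union (F : nat -> set T) (c : \bar R) n :
  (forall k, (k < n)%N -> (mass nu (F k) <= c)%E) ->
  (mass nu [set y | exists2 k, (k < n)%N & F k y] <= n%:R%:E * c)%E.
Proof.
elim: n => [|n IH] H.
  by rewrite (_ : [set y | _] = set0) ?mul0e ?/mass ?esum_set0//; apply/seteqP; split=> // y [].
have c0 : (0 <= c)%E by apply: le_trans (H 0%N _); rewrite ?mass_ge0.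
rewrite -natr1 EFinD ge0_muleDl// mul1e.
apply: le_trans (leeD (IH _) (H n _)) => //; last by move=> k kn; apply: H; rewrite ltnW.
apply: le_trans (esum_setU_le _ _ nu0); apply: esum_subset => //.
move=> y [k]; rewrite ltnS leq_eqVlt => /predU1P[->|kn] Fy; first by right.
by left; exists k.
Qed.

(** If [2 ^ j <= h1 < 2 ^ j.+1], then [j] and the exponents of the dyadic bands
met by the envelope satisfy [j - N <= i <= j + 2 * N], which gives [3 * N + 1]
bands. Consecutive dyadic bands lie in a common admissible band, so each of these
costs at most [2 * N] factors [K0], and one more factor compares the dyadic band
at [j] with the given band. *)
Lemma mass_envelope i : indices i ->
  (mass nu (envelope i) <=
   ((3 * N).+1%:R * K0 ^+ (2 * N) * K0)%:E * mass nu (index_band i))%E.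
Proof.
have KN : 1 <= K0 ^+ (2 * N) by rewrite exprn_ege1.
have C1 : 1 <= (3 * N).+1%:R * K0 ^+ (2 * N) * K0.
  by rewrite !mulr_ege1// ler1n.
case: i => x [h1 h2] [/= [-> ->]|/= adm].
  rewrite /index_band /= band_singleton (_ : envelope _ = [set x])//.
  by rewrite lee_pemull// mass_ge0.
have [h10 h2l h2h] := admissible_bounds adm.
rewrite /= in adm.
have /andP[jl jh] := trunc_log_bounds (isT : (1 < 2)%N) h10.
set j := trunc_log 2 h1 in jl jh.
have pos i : (0 < 2 ^ i)%N by rewrite expn_gt0.
have dyadic_le : (mass nu (dyadic x j) <= K0%:E * mass nu (band h1 h2 x))%E.
  apply: (@le_trans _ _ (K0%:E * mass nu (band h1 (2 * h1) x))%E); last first.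
    by rewrite lee_wpmul2l// mass_band_sub.
  apply: le_trans (@nu_doubling x h1 (2 * h1) (2 ^ j) (2 ^ j.+2) _ _ _ _) => //.
  - by apply: mass_band_sub; rewrite ?leq_exp2l.
  - by apply: admissible_nat; lia.
  - by apply: admissible_nat; rewrite // !expnS; lia.
  - by move: jh; rewrite !expnS; lia.
apply: (@le_trans _ _ ((3 * N).+1%:R%:E *
    ((K0 ^+ (2 * N))%:E * mass nu (dyadic x j)))%E); last first.
  rewrite muleA -EFinM [leRHS](_ : _ = ((3 * N).+1%:R * K0 ^+ (2 * N))%:E *
    (K0%:E * mass nu (index_band (x, (h1, h2)))))%E; last by rewrite muleA -EFinM.
  by rewrite lee_wpmul2l// lee_fin mulr_ge0// (le_trans _ KN).
(* The index k is i + N - j; the truncated difference can only add the band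
   of exponent 0 several times. *)
apply: le_trans (@mass_finite_union (fun k => dyadic x (k + j - N)) _ _ _).
  apply: esum_subset => // y; rewrite /envelope /= (gtn_eqF h10) => -[n [n0 h1n nh2 yx]].
  have /andP[il ih] := trunc_log_bounds (isT : (1 < 2)%N) n0.
  set i := trunc_log 2 n in il ih.
  have ji : (j < N + i.+1)%N.
    rewrite -(ltn_exp2l _ _ (isT : (1 < 2)%N)) expnD.
    apply: leq_ltn_trans jl _; apply: leq_ltn_trans h1n _.
    by rewrite ltn_pmul2l.
  have ij : (i < N + N + j.+1)%N.
    rewrite -(ltn_exp2l _ _ (isT : (1 < 2)%N)) !expnD.
    apply: leq_ltn_trans il _; apply: leq_trans nh2 _.
    rewrite -mulnA leq_pmul2l//; apply: leq_trans h2h _.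
    by rewrite leq_pmul2l// ltnW.
  exists (i + N - j)%N; first by move: ji ij; lia.
  exists n; split=> //.
  by rewrite (_ : (i + N - j + j - N)%N = i) ?il//; move: ji; lia.
move=> k kN; have [le|lt] := leqP (k + j - N) j.
  have := (dyadic_chain x (k + j - N) (j - (k + j - N))).2; rewrite subnKC// => H.
  apply: le_trans H _; rewrite lee_wpmul2r ?mass_ge0// lee_fin ler_weXn2l//; lia.
have := (dyadic_chain x j (k + j - N - j)).1; rewrite subnKC ?(ltnW lt)// => H.
apply: le_trans H _; rewrite lee_wpmul2r ?mass_ge0// lee_fin ler_weXn2l//; lia.
Qed.

Lemma covering_bound_bands :
  covering_bound (index_band @` indices) nu ((3 * N).+1%:R * K0 ^+ (2 * N) * K0).
Proof.
apply: (@covering_bound_indexed _ _ _ indices (lev \o fst) index_band envelope) => //=.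
- by rewrite !mulr_ge0// exprn_ge0.
- exact: meeting_sub_envelope.
- exact: mass_envelope.
Qed.

End Doubling.
End Envelope.
End Bands.

(** * Muckenhoupt weights *)

Section Muckenhoupt.
Context {R : realType} {T : choiceType}.
Variables (fam : set (set T)) (mu : T -> R).
Hypothesis mu_gt0 : forall x, 0 < mu x.
Hypothesis mu_fin : forall E, fam E -> (mass mu E < +oo)%E.
Hypothesis fam_singleton : forall x, fam [set x].

Lemma wmul_gt0 (w : T -> R) : (forall x, 0 < w x) -> forall x, 0 < wmul mu w x.
Proof. by move=> w0 x; rewrite mulr_gt0. Qed.

Section Ap.
Variables (p : R) (w : T -> R).
Hypothesis p_gt1 : 1 < p.
Hypothesis w_gt0 : forall x, 0 < w x.

Let s y := w y `^ (- (p - 1)^-1).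
Let p1_gt0 : 0 < p - 1. Proof. by rewrite subr_gt0. Qed.
Let p_gt0 : 0 < p. Proof. exact: lt_trans p_gt1. Qed.
Let s_gt0 x : 0 < s x. Proof. exact: powR_gt0. Qed.

Let wmu := wmul mu w.
Let smu := wmul mu s.

(** Finiteness of the constant forces both masses to be finite, as neither
average vanishes. *)
Lemma Ap_bound : (Ap_const fam mu p w < +oo)%E ->
  exists2 C : R, 0 < C & forall E z, fam E -> E z ->
  exists a b c : R, [/\ [/\ 0 < a, 0 < b & 0 < c],
    [/\ mass wmu E = a%:E, mass smu E = b%:E & mass mu E = c%:E]
    & a * b `^ (p - 1) <= C * c `^ p].
Proof.
move=> Aoo; have w0 := wmul_gt0 w_gt0; have s0 := wmul_gt0 s_gt0.
set A := Ap_const fam mu p w in Aoo.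
exists (Num.max 1 (fine A)); first by rewrite lt_max ltr01.
move=> E z fE Ez; have [c [c0 mE cE]] := divide_mass mu_gt0 Ez (mu_fin fE).
have W0 : (0 < mass wmu E)%E := mass_gt0 w0 Ez.
have S0 : (0 < mass smu E)%E := mass_gt0 s0 Ez.
have : (average mu w E * (average mu s E) `^ (p - 1) <= A)%E.
  by apply: ereal_sup_ubound; exists E.
rewrite /average cE -/wmu -/smu.
have ci0 : (0 < (c^-1)%:E :> \bar R)%E by rewrite lte_fin invr_gt0.
case WE : (mass wmu E) W0 => [a| |] // a0; last first.
  rewrite gt0_mulye// gt0_mulye ?poweR_gt0 ?mule_gt0// => /(lt_le_trans Aoo).
  by rewrite ltxx.
case SE : (mass smu E) S0 => [b| |] // b0; last first.
  rewrite gt0_mulye// poweRyr ?gt_eqF// gt0_muley ?mule_gt0// => /(lt_le_trans Aoo).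
  by rewrite ltxx.
move: a0 b0; rewrite !lte_fin => a0 b0.
rewrite -!EFinM => le.
exists a, b, c; split=> //.
have finA : A \is a fin_num.
  by rewrite fin_numE -ltey Aoo andbT -ltNye (lt_le_trans _ le)// ltNyr.
have {}le : a / c * (b / c) `^ (p - 1) <= Num.max 1 (fine A).
  by rewrite le_max -[X in _ || X]lee_fin fineK// le orbT.
have cp : 0 < c `^ (p - 1) by rewrite powR_gt0.
rewrite -(mulr_powRB1 (ltW c0) p_gt0) mulrA -ler_pdivrMr// -ler_pdivrMr//.
apply: le_trans le; rewrite powRM ?(ltW b0) ?invr_ge0 ?(ltW c0)//.
rewrite -powR_inv1 ?(ltW c0)// -powRrM mulN1r !powRN powRr1 ?(ltW c0)//.
by rewrite [leRHS](_ : _ = a * b `^ (p - 1) / c `^ (p - 1) / c)//; ring.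
Qed.

(** Converse to the $A_p$ inequality, valid for every set: it plays the role of
Hoelder's inequality. Since [t * w >= 1] or [(t * w) `^ - (p - 1)^-1 >= 1], the
mass of the set is at most [t * a + t `^ - (p - 1)^-1 * b] for each [t > 0]; the
value of [t] below makes the first term one half of the mass. *)
Lemma mass_le_product (E : set T) (a b c : R) :
  0 < a -> 0 < b -> 0 < c ->
  mass wmu E = a%:E -> mass smu E = b%:E -> mass mu E = c%:E ->
  c `^ p <= 2 `^ p * (a * b `^ (p - 1)).
Proof.
move=> a0 b0 c0 WE SE ME; set k := (p - 1)^-1.
have k0 : 0 < k by rewrite invr_gt0.
have tP t : 0 < t -> c <= t * a + t `^ (- k) * b.
  move=> t0; rewrite -lee_fin EFinD !EFinM -ME -WE -SE.
  have w0 := wmul_gt0 w_gt0; have s0 := wmul_gt0 s_gt0.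
  rewrite -!massZ ?powR_ge0 ?(ltW t0)// -esumD; last 2 first.
  - by move=> y _; rewrite -EFinM lee_fin mulr_ge0// ltW.
  - by move=> y _; rewrite -EFinM lee_fin mulr_ge0 ?powR_ge0// ltW.
  apply: le_esum => y _; rewrite -!EFinM -EFinD lee_fin /wmu /smu /wmul /s.
  rewrite mulrA [X in _ + X]mulrA -mulrDl ler_peMl ?(ltW (mu_gt0 y))//.
  rewrite -powRM ?(ltW t0) ?(ltW (w_gt0 y))//.
  have u0 : 0 < t * w y by rewrite mulr_gt0.
  have [u1|u1] := leP 1 (t * w y); first by rewrite ler_wpDr ?powR_ge0.
  rewrite ler_wpDl ?(ltW u0)// powRN invf_ge1 ?powR_gt0//.
  have E1 : 1 `^ k = 1 :> R by rewrite powR1.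
  by rewrite -[leRHS]E1 ge0_ler_powR ?nnegrE ?(ltW k0) ?(ltW u0) ?(ltW u1).
pose t := c / (2 * a); have t0 : 0 < t by rewrite divr_gt0// mulr_gt0.
have := tP _ t0; rewrite (_ : t * a = c / 2); last by rewrite /t; field; rewrite gt_eqF.
rewrite -lerBlDl (_ : c - c / 2 = c / 2); last by field.
have c2 : 0 < c / 2 by rewrite divr_gt0.
move=> /(@ge0_ler_powR R (p - 1) (ltW p1_gt0)); rewrite !nnegrE.
have tb : 0 <= t `^ (- k) * b by rewrite mulr_ge0 ?powR_ge0 ?(ltW b0).
move=> /(_ (ltW c2) tb).
rewrite [leRHS]powRM ?powR_ge0 ?(ltW b0)// -powRrM mulNr mulVf ?gt_eqF//.
rewrite powR_inv1 ?(ltW t0)// => le.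
have : (c / 2) * (c / 2) `^ (p - 1) <= a * b `^ (p - 1).
  apply: le_trans (ler_wpM2l (ltW c2) le) _.
  rewrite mulrA (_ : c / 2 * t^-1 = a)//.
  by rewrite /t; field; rewrite !gt_eqF.
rewrite (mulr_powRB1 (ltW c2) p_gt0) => le2.
rewrite -[c in leLHS](_ : 2 * (c / 2) = c); last by field.
by rewrite powRM ?(ltW c2)// ler_wpM2l ?powR_ge0.
Qed.

(** Let [a] and [b] be the masses of a set for [w mu] and [s mu]. Passing from [F]
to [E] decreases [a * b `^ (p - 1)] by a bounded factor only; since neither
factor increases, each of them separately decreases by a bounded factor. *)
Lemma Ap_doubling (r : R) : (Ap_const fam mu p w < +oo)%E ->
  exists2 D : R, 1 <= D & forall E F z, fam E -> fam F -> E z -> E `<=` F ->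
    (mass mu F <= r%:E * mass mu E)%E ->
    (mass wmu F <= D%:E * mass wmu E)%E /\ (mass smu F <= D%:E * mass smu E)%E.
Proof.
move=> /Ap_bound[C C0 CP]; pose D := C * (`|r| `^ p * 2 `^ p).
have D0 : 0 <= D by rewrite !mulr_ge0 ?powR_ge0// ltW.
exists (Num.max 1 (Num.max D (D `^ (p - 1)^-1))); first by rewrite le_max lexx.
move=> E F z fE fF Ez EF.
have [aE [bE [cE [[aE0 bE0 cE0] [WE SE ME] _]]]] := CP _ _ fE Ez.
have [aF [bF [cF [[aF0 bF0 cF0] [WF SF MF] le]]]] := CP _ _ fF (EF _ Ez).
rewrite MF ME -EFinM lee_fin => cFE.
have aEF : aE <= aF.
  by rewrite -lee_fin -WE -WF; apply: esum_subset => // y; rewrite lee_fin ltW ?wmul_gt0.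
have bEF : bE <= bF.
  by rewrite -lee_fin -SE -SF; apply: esum_subset => // y; rewrite lee_fin ltW ?wmul_gt0.
have bE1 : 0 < bE `^ (p - 1) by rewrite powR_gt0.
have bF1 : 0 < bF `^ (p - 1) by rewrite powR_gt0.
have bEF1 : bE `^ (p - 1) <= bF `^ (p - 1).
  by rewrite ge0_ler_powR ?nnegrE ?(ltW p1_gt0) ?(ltW bE0) ?(ltW bF0).
have main : aF * bF `^ (p - 1) <= D * (aE * bE `^ (p - 1)).
  apply: le_trans le _; rewrite /D -!mulrA ler_wpM2l ?(ltW C0)//.
  apply: le_trans (_ : (`|r| * cE) `^ p <= _).
    rewrite ge0_ler_powR ?nnegrE ?(ltW p_gt0) ?(ltW cF0) ?mulr_ge0 ?(ltW cE0)//.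
    by apply: le_trans cFE _; rewrite ler_wpM2r ?(ltW cE0) ?ler_norm.
  rewrite powRM ?(ltW cE0)// ler_wpM2l ?powR_ge0//.
  exact: (mass_le_product aE0 bE0 cE0 WE SE ME).
have aFE : aF <= D * aE.
  rewrite -(ler_pM2r bF1); apply: le_trans main _; rewrite -[leRHS]mulrA.
  by rewrite ler_wpM2l// ler_wpM2l// ltW.
have bFE : bF <= D `^ (p - 1)^-1 * bE.
  have : bF `^ (p - 1) <= D * bE `^ (p - 1).
    rewrite -(ler_pM2l aF0); apply: le_trans main _; rewrite [leRHS]mulrCA.
    by rewrite ler_wpM2l// ler_wpM2r// ltW.
  have k0 : 0 <= (p - 1)^-1 by rewrite invr_ge0 ltW.
  move=> /(ge0_ler_powR k0); rewrite !nnegrE mulr_ge0 ?powR_ge0// => /(_ isT isT).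
  rewrite powRM ?powR_ge0// -!powRrM mulfV ?gt_eqF// !powRr1 ?(ltW bE0) ?(ltW bF0)//.
rewrite WE WF SE SF -!EFinM !lee_fin; split.
  by apply: le_trans aFE _; rewrite ler_wpM2r ?(ltW aE0)// !le_max lexx orbT.
by apply: le_trans bFE _; rewrite ler_wpM2r ?(ltW bE0)// !le_max lexx !orbT.
Qed.

(** The pointwise bound behind the strong type inequality. On a set [E] write the
average of [|f|] with respect to [mu] as the average [x] of [|f| / s] with
respect to [s mu], times a ratio of masses which the $A_p$ condition controls.
The maximal function of [|f| / s] is at least [x] on all of [E], so [x] can be
replaced by an average with respect to [w mu] of a power of it. *)
Lemma maximal_le_iterated : (Ap_const fam mu p w < +oo)%E ->
  exists2 C : R, 0 < C & forall (f : T -> R) z,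
    (maximal fam mu f z <= (C%:E * weighted_maximal fam wmu (fun y =>
       (weighted_maximal fam smu (fun x => (`|f x| / s x)%:E) y) `^ (p - 1) *
       ((w y)^-1)%:E) z) `^ (p - 1)^-1)%E.
Proof.
move=> /Ap_bound[C C0 CP]; exists C => // f z.
set F : T -> \bar R := fun x => (`|f x| / s x)%:E.
set G := weighted_maximal fam smu F.
have s0 := wmul_gt0 s_gt0; have w0 := wmul_gt0 w_gt0.
have F0 x : (0 <= F x)%E by rewrite lee_fin divr_ge0// ltW.
have G0 y : (0 <= G y)%E by apply: weighted_maximal_ge0.
apply: ge_ereal_sup => _ [E [fE Ez] <-].
have [a [b [c [[a0 b0 c0] [WE SE ME] le]]]] := CP _ _ fE Ez.
set A := mass (wmul mu (fun y => `|f y|)) E.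
have AE : A = \esum_(y in E) (F y * (smu y)%:E)%E.
  apply: eq_esum => y _; rewrite -EFinM; congr EFin.
  by rewrite /smu /wmul mulrA divfK// gt_eqF.
have A0 : (0 <= A)%E by apply: esum_ge0 => y _; rewrite lee_fin mulr_ge0 ?normr_ge0// ltW.
set x := (A * (b^-1)%:E)%E.
have x0 : (0 <= x)%E by rewrite mule_ge0// lee_fin invr_ge0 ltW.
have xG y : E y -> (x <= G y)%E.
  move=> Ey; apply: ereal_sup_ubound; exists E => //.
  by rewrite SE inver gt_eqF// -AE.
set H := weighted_maximal fam wmu _ z.
have xH : (x `^ (p - 1) * (c / a)%:E <= H)%E.
  apply: (@le_trans _ _ ((\esum_(y in E)
      (G y `^ (p - 1) * ((w y)^-1)%:E * (wmu y)%:E)) / mass wmu E)%E); last first.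
    by apply: ereal_sup_ubound; exists E.
  rewrite WE inver gt_eqF// EFinM muleA lee_wpmul2r ?lee_fin ?invr_ge0 ?(ltW a0)//.
  (* The case of infinite x is separate because a constant is taken out of a sum
     only when it is finite. *)
  have [xoo|xfin] := eqVneq x +oo%E; last first.
    have xr : (x `^ (p - 1))%E \is a fin_num.
      by rewrite fin_num_poweR// ge0_fin_numE// ltey.
    rewrite -(fineK xr) -ME -massZ//; last by rewrite fine_ge0// poweR_ge0.
    apply: le_esum => y Ey; rewrite fineK// -muleA -EFinM /wmu /wmul mulKf ?gt_eqF//.
    rewrite lee_wpmul2r ?lee_fin ?(ltW (mu_gt0 y))//.
    apply: gt0_ler_poweR; rewrite ?(ltW p1_gt0) ?in_itv/= ?andbT ?leey ?x0 ?G0//.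
    exact: xG.
  have Gz : G z = +oo%E by apply/eqP; rewrite -leye_eq -xoo xG.
  apply: le_trans (@esum_term _ _ E (fun y => G y `^ (p - 1) * ((w y)^-1)%:E * (wmu y)%:E)%E z _ Ez).
    rewrite Gz poweRyr ?gt_eqF// -muleA -EFinM /wmu /wmul mulKf ?gt_eqF//.
    by rewrite gt0_mulye ?lte_fin// leey.
  by move=> y; rewrite !mule_ge0 ?poweR_ge0 ?lee_fin ?invr_ge0 ?ltW.
have bc : (b / c) `^ (p - 1) <= C * (c / a).
  rewrite powRM ?(ltW b0) ?invr_ge0 ?(ltW c0)//.
  rewrite -powR_inv1 ?(ltW c0)// -powRrM mulN1r powRN.
  rewrite ler_pdivrMr ?powR_gt0// -(ler_pM2l a0).
  apply: le_trans le _; rewrite -(mulr_powRB1 (ltW c0) p_gt0).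
  by rewrite [leRHS](_ : _ = C * (c * c `^ (p - 1)))//; field; rewrite gt_eqF.
have -> : average mu (fun y => `|f y|) E = (x * (b / c)%:E)%E.
  rewrite /average ME inver gt_eqF// /x -muleA -EFinM mulrA mulVf ?gt_eqF//.
  by rewrite mul1r.
have y0 : (0 <= x * (b / c)%:E)%E by rewrite mule_ge0// lee_fin divr_ge0// ltW.
rewrite [leLHS](_ : _ = ((x * (b / c)%:E) `^ (p - 1)) `^ (p - 1)^-1)%E; last first.
  by rewrite -poweRrM mulfV ?gt_eqF// poweRe1.
have H0 : (0 <= H)%E.
  by apply: le_trans xH; rewrite mule_ge0 ?poweR_ge0// lee_fin divr_ge0// ltW.
apply: gt0_ler_poweR.
- by rewrite invr_ge0 ltW.
- by rewrite in_itv/= poweR_ge0 leey.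
- by rewrite in_itv/= leey andbT mule_ge0// lee_fin ltW.
rewrite poweRM ?lee_fin ?divr_ge0 ?(ltW b0) ?(ltW c0)//.
apply: (@le_trans _ _ (x `^ (p - 1) * (C * (c / a))%:E)%E).
  by rewrite lee_wpmul2l ?poweR_ge0// lee_fin.
by rewrite EFinM muleCA lee_wpmul2l// lee_fin ltW.
Qed.

Lemma maximal_ge0 (f : T -> R) z : (0 <= maximal fam mu f z)%E.
Proof.
apply: (@weighted_maximal_ge0 _ _ fam mu mu_gt0 (fun y => `|f y|%:E) z) => // y.
Qed.

(** The two exponents are tuned so that the conjugate exponent [p / (p - 1)],
applied for [w mu], turns the inner power into [p], and the two weights recombine
to [s mu] and then to [w mu]. *)
Lemma Ap_strong_bound (Kw Ks : R) : 0 < Kw -> 0 < Ks ->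
  (Ap_const fam mu p w < +oo)%E ->
  covering_bound fam wmu Kw -> covering_bound fam smu Ks ->
  bounded_Lp mu p w (maximal fam mu).
Proof.
move=> Kw0 Ks0 Aoo covw covs.
have s0 := wmul_gt0 s_gt0; have w0 := wmul_gt0 w_gt0.
have [C C0 CP] := maximal_le_iterated Aoo.
have [D D0 DP] := Ap_bound Aoo.
have fin_of (m : T -> R) : (forall E z, fam E -> E z -> (mass m E < +oo)%E) ->
    forall E, fam E -> (mass m E < +oo)%E.
  move=> H E fE; have [->|/set0P[z Ez]] := eqVneq E set0.
    by rewrite /mass esum_set0.
  exact: H Ez.
have wfin : forall E, fam E -> (mass wmu E < +oo)%E.
  apply: fin_of => E z fE Ez.
  by have [a [b [c [_ [-> _ _] _]]]] := DP _ _ fE Ez; rewrite ltry.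
have sfin : forall E, fam E -> (mass smu E < +oo)%E.
  apply: fin_of => E z fE Ez.
  by have [a [b [c [_ [_ -> _] _]]]] := DP _ _ fE Ez; rewrite ltry.
pose q := (p - 1)^-1 * p.
have q1 : 1 < q by rewrite /q ltr_pdivlMl// mulr1 ltrBlDr ltrDl.
have [Cw Cw0 CwP] := weighted_maximal_strong w0 wfin covw Kw0 q1.
have [Cs Cs0 CsP] := weighted_maximal_strong s0 sfin covs Ks0 p_gt1.
pose K := C `^ q * (Cw * Cs).
have K0 : 0 < K by rewrite !mulr_gt0// powR_gt0.
exists (K `^ p^-1) => f _; rewrite /Lp_norm -poweR_EFin.
have Lp0 (u : T -> \bar R) : (0 <= \esum_(y in [set: T]) (`|u y| `^ p * (wmul mu w y)%:E))%E.
  by apply: esum_ge0 => y _; rewrite mule_ge0 ?poweR_ge0// lee_fin ltW.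
rewrite -poweRM ?lee_fin ?(ltW K0)//.
apply: gt0_ler_poweR.
- by rewrite invr_ge0 ltW.
- by rewrite in_itv/= leey andbT.
- by rewrite in_itv/= leey andbT mule_ge0 ?lee_fin ?(ltW K0)//; exact: (Lp0 (EFin \o f)).
set F : T -> \bar R := fun x => (`|f x| / s x)%:E.
set G := weighted_maximal fam smu F.
have F0 x : (0 <= F x)%E by rewrite lee_fin divr_ge0// ltW.
have G0 y : (0 <= G y)%E by apply: weighted_maximal_ge0.
set g := fun y => (G y `^ (p - 1) * ((w y)^-1)%:E)%E.
have g0 y : (0 <= g y)%E by rewrite mule_ge0 ?poweR_ge0// lee_fin invr_ge0 ltW.
set H := weighted_maximal fam wmu g.
have H0 y : (0 <= H y)%E by apply: weighted_maximal_ge0.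
apply: (@le_trans _ _ (\esum_(y in [set: T]) ((C `^ q)%:E * (H y `^ q * (wmu y)%:E)))%E).
  apply: le_esum => y _; rewrite muleA lee_wpmul2r ?lee_fin ?(ltW (w0 y))//.
  rewrite gee0_abs ?maximal_ge0// -poweR_EFin -poweRM ?lee_fin ?(ltW C0)//.
  rewrite /q poweRrM; apply: gt0_ler_poweR; rewrite ?(ltW p_gt0)//.
  - by rewrite in_itv/= leey andbT maximal_ge0.
  - by rewrite in_itv/= leey andbT poweR_ge0.
rewrite esumZl ?powR_ge0//; last first.
  by move=> y; rewrite mule_ge0 ?poweR_ge0// lee_fin ltW.
rewrite /K EFinM -muleA lee_wpmul2l ?lee_fin ?powR_ge0//.
apply: le_trans (CwP g g0 H0) _.
rewrite EFinM -muleA lee_wpmul2l ?lee_fin ?(ltW Cw0)//.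
have gG y : (g y `^ q * (wmu y)%:E = G y `^ p * (smu y)%:E)%E.
  rewrite /g poweRM ?poweR_ge0 ?lee_fin ?invr_ge0 ?(ltW (w_gt0 y))//.
  rewrite -poweRrM /q mulrA mulfV ?gt_eqF// mul1r -muleA; congr (_ * _)%E.
  rewrite poweR_EFin -EFinM; congr EFin.
  rewrite /wmu /smu /wmul /s mulrA; congr (_ * _).
  rewrite -powR_inv1 ?(ltW (w_gt0 y))// -powRrM -{2}(powRr1 (ltW (w_gt0 y))).
  rewrite -powRD; last by rewrite (gt_eqF (w_gt0 y)) implybT.
  by congr (_ `^ _); field; rewrite gt_eqF.
rewrite (eq_esum (fun y _ => gG y)).
apply: le_trans (CsP F F0 G0) _.
rewrite lee_wpmul2l ?lee_fin ?(ltW Cs0)//.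
apply: le_esum => y _; rewrite /F /= -!EFinM lee_fin.
rewrite powRM ?normr_ge0 ?invr_ge0 ?(ltW (s_gt0 y))// -mulrA ler_wpM2l ?powR_ge0//.
rewrite le_eqVlt; apply/orP; left; apply/eqP.
rewrite /smu /wmul /s mulrA; congr (_ * _).
rewrite -powRN opprK -powRrM -powRD; last by rewrite (gt_eqF (w_gt0 y)) implybT.
rewrite -[RHS](powRr1 (ltW (w_gt0 y))); congr (_ `^ _).
by field; rewrite gt_eqF.
Qed.

End Ap.

Section A1.
Variable w : T -> R.
Hypothesis w_gt0 : forall x, 0 < w x.

Let wmu := wmul mu w.

(** The essential supremum is a supremum because every point has positive mass. *)
Lemma A1_bound : (A1_const fam mu w < +oo)%E ->
  exists2 C : R, 0 < C & forall E z, fam E -> E z ->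
  exists a c : R, [/\ 0 < a, 0 < c, mass wmu E = a%:E, mass mu E = c%:E
    & forall y, E y -> a <= C * c * w y].
Proof.
move=> Aoo; have w0 := wmul_gt0 w_gt0.
set A := A1_const fam mu w in Aoo.
exists (Num.max 1 (fine A)); first by rewrite lt_max ltr01.
move=> E z fE Ez; have [c [c0 mE cE]] := divide_mass mu_gt0 Ez (mu_fin fE).
have W0 : (0 < mass wmu E)%E := mass_gt0 w0 Ez.
have ci0 : (0 < (c^-1)%:E :> \bar R)%E by rewrite lte_fin invr_gt0.
have linf y : E y -> (((w y)^-1)%:E <= Linfty_norm mu E (fun y => (w y)^-1%R))%E.
  move=> Ey; apply: le_ereal_inf_tmp => M [M0 null].
  rewrite leNgt; apply/negP => lt; have /eqP := null; apply/negP.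
  rewrite gt_eqF//; apply: (mass_gt0 mu_gt0 (z := y)); split=> //=.
  by rewrite ger0_norm// invr_ge0 ltW.
have bound y : E y -> (mass wmu E * (c^-1)%:E * ((w y)^-1)%:E <= A)%E.
  move=> Ey; apply: (@le_trans _ _ (average mu w E * Linfty_norm mu E (fun y => (w y)^-1%R))%E).
    by rewrite /average cE lee_wpmul2l ?linf// mule_ge0// ltW.
  by apply: ereal_sup_ubound; exists E.
case WE : (mass wmu E) W0 bound => [a| |] // a0 bound; last first.
  have := bound _ Ez; rewrite gt0_mulye// gt0_mulye ?lte_fin ?invr_gt0//.
  by move=> /(lt_le_trans Aoo); rewrite ltxx.
exists a, c; split=> // y Ey.
have finA : A \is a fin_num.
  rewrite fin_numE -ltey Aoo andbT -ltNye (lt_le_trans _ (bound _ Ey))//.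
  by rewrite -!EFinM ltNyr.
have : a / c / w y <= Num.max 1 (fine A).
  by rewrite le_max -[X in _ || X]lee_fin fineK// !EFinM bound ?orbT.
by rewrite !ler_pdivrMr// mulrAC.
Qed.

(** Integrate the pointwise bound on [F] over the smaller set [E]. *)
Lemma A1_doubling (r : R) : (A1_const fam mu w < +oo)%E ->
  exists2 D : R, 1 <= D & forall E F z, fam E -> fam F -> E z -> E `<=` F ->
    (mass mu F <= r%:E * mass mu E)%E -> (mass wmu F <= D%:E * mass wmu E)%E.
Proof.
move=> /A1_bound[C C0 CP]; have w0 := wmul_gt0 w_gt0.
exists (Num.max 1 (C * r)); first by rewrite le_max lexx.
move=> E F z fE fF Ez EF.
have [aE [cE [aE0 cE0 WE ME _]]] := CP _ _ fE Ez.
have [aF [cF [aF0 cF0 WF MF le]]] := CP _ _ fF (EF _ Ez).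
rewrite MF ME -EFinM lee_fin => cFE; rewrite WF WE -EFinM lee_fin.
have main : aF * cE <= C * cF * aE.
  rewrite -lee_fin EFinM (EFinM (C * cF)) -ME -WE.
  have CF0 : 0 <= C * cF by rewrite mulr_ge0// ltW.
  rewrite -!massZ ?(ltW aF0)//; apply: le_esum => y Ey.
  rewrite -!EFinM lee_fin /wmu /wmul mulrA ler_wpM2r ?(ltW (mu_gt0 y))//.
  exact/le/EF.
rewrite -(ler_pM2r cE0); apply: le_trans main _.
apply: (@le_trans _ _ (C * r * aE * cE)); last first.
  by rewrite ler_wpM2r ?(ltW cE0)// ler_wpM2r ?(ltW aE0)// le_max lexx orbT.
rewrite [leRHS](_ : _ = C * (r * cE) * aE); last by ring.
by rewrite ler_wpM2r ?(ltW aE0)// ler_wpM2l ?(ltW C0).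
Qed.

(** On a set [E] whose average of [|f|] exceeds [t], the $A_1$ condition turns
this average with respect to [mu] into one with respect to [w mu], which is the
hypothesis of the covering bound with density [C * |f| * w * mu]. *)
Lemma A1_weak_bound (K : R) : 0 <= K -> (A1_const fam mu w < +oo)%E ->
  covering_bound fam wmu K -> bounded_Lp_weak mu 1 w (maximal fam mu).
Proof.
move=> K0 /A1_bound[C C0 CP] cov; have w0 := wmul_gt0 w_gt0.
exists (K * C) => f _; rewrite /weak_Lp_norm /Lp_norm invr1.
have fw0 y : (0 <= (`|f y| * wmu y)%:E)%E by rewrite lee_fin mulr_ge0// ltW.
have -> : \esum_(y in [set: T]) (`|(EFin \o f) y| `^ 1 * (wmul mu w y)%:E)%E =
    \esum_(y in [set: T]) (`|f y| * wmu y)%:E.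
  by apply: eq_esum => y _; rewrite poweRe1.
rewrite [X in (_ * X)%E]poweRe1 ?esum_ge0//.
apply: ge_ereal_sup => _ [t t0 <-]; rewrite /= in t0.
rewrite poweRe1 ?mass_ge0// EFinM -muleA -(esumZl _ fw0 (ltW C0)).
apply: cov => // [y|z /=]; first by rewrite mule_ge0// lee_fin ltW.
rewrite gee0_abs ?maximal_ge0// => /ereal_sup_gt[_ [E [fE Ez] <-]].
have [a [c [a0 c0 WE ME le]]] := CP _ _ fE Ez.
rewrite /average ME inver gt_eqF// lte_pdivlMr// => lt.
exists E; split=> //; rewrite WE -(@lee_pmul2l _ c%:E) ?lte_fin//.
apply: (@le_trans _ _ (a%:E * mass (wmul mu (fun y => `|f y|%R)) E)%E).
  rewrite (_ : (c%:E * (t%:E * a%:E) = a%:E * (t%:E * c%:E))%E); last first.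
    by rewrite -!EFinM; congr EFin; ring.
  by rewrite lee_wpmul2l ?lee_fin ?(ltW a0) ?(ltW lt).
rewrite /mass -!esumZl ?(ltW a0) ?(ltW c0)//; last 2 first.
- by move=> y; rewrite mule_ge0// lee_fin ltW.
- by move=> y; rewrite lee_fin mulr_ge0// ltW.
apply: le_esum => y Ey; rewrite -!EFinM lee_fin /wmu /wmul.
rewrite [leRHS](_ : _ = C * c * w y * (`|f y| * mu y)); last by ring.
by rewrite ler_wpM2r ?le// mulr_ge0// ltW.
Qed.

End A1.
End Muckenhoupt.

(** * Muckenhoupt weights on families of bands *)

Section BandWeights.
Context {R : realType} {T : choiceType}.
Variables (par : T -> T) (lev mu : T -> R) (beta : R) (N : nat).
Hypothesis lev_par : forall x, lev (par x) = lev x + 1.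
Hypothesis mu_gt0 : forall x, 0 < mu x.
Hypothesis mu_flow : forall x,
  (mu x)%:E = \esum_(y in [set y | par y = x]) (mu y)%:E.
Hypothesis beta_ge4 : 4 <= beta.
Hypothesis beta_le : beta <= 2 ^+ N.

Let fam : set (set T) := index_band par @` indices beta.

Lemma singleton_band_family x : fam [set x].
Proof.
by exists (x, (0%N, 1%N)); [left|rewrite /index_band /= (band_singleton par)].
Qed.

Lemma mass_band_diff h1 h2 x : (h1 <= h2)%N ->
  mass mu (band par h1 h2 x) = ((h2 - h1)%:R * mu x)%:E.
Proof. by move=> h12; rewrite -{1}(subnKC h12) (mass_band lev_par mu_gt0 mu_flow). Qed.

Lemma mass_band_family_fin E : fam E -> (mass mu E < +oo)%E.
Proof.
case=> -[x [h1 h2]] /= Di <-; rewrite /index_band /=.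
rewrite mass_band_diff ?ltry//; case: Di => [[-> ->]//|[_ /ltnW]]; exact.
Qed.

(** The mass of a band is, up to a factor 2, its upper height times the mass of
the root; for nested bands the upper heights are comparable since the lower ones
are ordered. *)
Lemma band_comparable a b a' b' x :
  admissible beta a b -> admissible beta a' b' -> (a' <= a)%N ->
  (mass mu (band par a' b' x) <= (2 ^+ N)%:E * mass mu (band par a b x))%E.
Proof.
move=> /(admissible_bounds beta_le)[a0 ab _] /(admissible_bounds beta_le)[a'0 ab' b'N] aa.
rewrite !mass_band_diff; [|lia|lia].
rewrite -EFinM lee_fin mulrA ler_wpM2r ?(ltW (mu_gt0 x))//.
rewrite -natrX -natrM ler_nat; have := expn_gt0 2 N; nia.
Qed.

Lemma band_nonempty a b x : admissible beta a b -> exists z, band par a b x z.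
Proof.
move=> /(admissible_bounds beta_le)[a0 ab _]; apply/set0P/eqP => E0.
have ab' : (a <= b)%N by lia.
have := mass_band_diff x ab'.
rewrite E0 /mass esum_set0 => -[/esym/eqP]; rewrite mulf_eq0 (gt_eqF (mu_gt0 x)) orbF.
by rewrite pnatr_eq0; lia.
Qed.

Lemma covering_bound_of_doubling (nu : T -> R) (D : R) :
  (forall x, 0 < nu x) -> 1 <= D ->
  (forall E F z, fam E -> fam F -> E z -> E `<=` F ->
     (mass mu F <= (2 ^+ N)%:E * mass mu E)%E -> (mass nu F <= D%:E * mass nu E)%E) ->
  exists2 K : R, 0 < K & covering_bound fam nu K.
Proof.
move=> nu0 D1 H; exists ((3 * N).+1%:R * D ^+ (2 * N) * D).
  have D0 : 0 < D by rewrite (lt_le_trans _ D1).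
  by rewrite !mulr_gt0// ?ltr0n// exprn_gt0.
apply: (covering_bound_bands lev_par beta_ge4 beta_le nu0 D1).
move=> x a b a' b' ad ad' aa bb; have [z Ez] := band_nonempty x ad.
apply: (H (band par a b x) (band par a' b' x) z) => //.
- by exists (x, (a, b)) => //; right.
- by exists (x, (a', b')) => //; right.
- exact: band_sub.
- exact: band_comparable.
Qed.

Lemma band_maximal_Ap (p : R) (w : T -> R) : 1 < p -> in_Ap fam mu p w ->
  bounded_Lp mu p w (maximal fam mu).
Proof.
move=> p1 [w0 Aoo].
have s0 x : 0 < w x `^ (- (p - 1)^-1) by rewrite powR_gt0.
have [D D1 DP] := Ap_doubling mu_gt0 mass_band_family_fin p1 w0 (2 ^+ N) Aoo.
have [Kw Kw0 covw] := covering_bound_of_doubling (wmul_gt0 mu_gt0 w0) D1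
  (fun E F z fE fF Ez EF le => (DP E F z fE fF Ez EF le).1).
have [Ks Ks0 covs] := covering_bound_of_doubling (wmul_gt0 mu_gt0 s0) D1
  (fun E F z fE fF Ez EF le => (DP E F z fE fF Ez EF le).2).
exact: (Ap_strong_bound mu_gt0 mass_band_family_fin singleton_band_family p1 w0
  Kw0 Ks0 Aoo covw covs).
Qed.

Lemma band_maximal_A1 (w : T -> R) : in_A1 fam mu w ->
  bounded_Lp_weak mu 1 w (maximal fam mu).
Proof.
move=> [w0 Aoo].
have [D D1 DP] := A1_doubling mu_gt0 mass_band_family_fin w0 (2 ^+ N) Aoo.
have [K K0 cov] := covering_bound_of_doubling (wmul_gt0 mu_gt0 w0) D1 DP.
exact: (A1_weak_bound mu_gt0 mass_band_family_fin singleton_band_family w0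
  (ltW K0) Aoo cov).
Qed.

End BandWeights.

Lemma trapezoids_bands {R : realType} {T : choiceType} (adj : rel T)
    (omega : set (nat -> T)) (par : T -> T) (beta : R) :
  is_tree adj ->
  (forall x y, below omega x y <-> exists n, iter n par x = y) ->
  (forall n x, gdist adj x (iter n par x) = n) ->
  trapezoids adj omega beta = index_band par @` indices beta.
Proof.
move=> [sym _ conn _] belowP dist.
have trapE h1 h2 x : trapezoid adj omega h1 h2 x = band par h1 h2 x.
  apply/seteqP; split=> [y [/belowP[n yx]]|y [n [hn yx]]].
    by rewrite (gdist_sym sym conn) -[X in gdist adj y X]yx dist => hn; exists n.
  split; first by apply/belowP; exists n.
  by rewrite (gdist_sym sym conn) -[X in gdist adj y X]yx dist.
apply/seteqP; split=> E.
  move=> [[x ->]|[x [h1 [h2 [adm ->]]]]].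
    by exists (x, (0%N, 1%N)); [left|rewrite /index_band /= (band_singleton par)].
  by exists (x, (h1, h2)); [right|rewrite trapE].
move=> [[x [h1 h2]] /= [/= [-> ->]|/= adm] <-]; rewrite /index_band /=.
  by left; exists x; rewrite (band_singleton par).
by right; exists x, h1, h2; rewrite trapE.
Qed.

Theorem theorem2p9 (R : realType) (T : choiceType) (adj : rel T)
    (tree_T : is_tree adj) (infinite_T : infinite_set [set: T])
    (omega : set (nat -> T)) (boundary_omega : boundary adj omega)
    (o : T) (xs : nat -> T) (omega_xs : omega xs) (xs0 : xs 0%N = o)
    (mu : T -> R) (flow_mu : flow_measure adj xs mu)
    (beta : R) (beta_ge12 : 12 <= beta) :
  (forall (p : R) (w : T -> R), 1 < p ->
     in_Ap (trapezoids adj omega beta) mu p w ->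
     bounded_Lp mu p w (maximal (trapezoids adj omega beta) mu)) /\
  (forall w : T -> R,
     in_A1 (trapezoids adj omega beta) mu w ->
     bounded_Lp_weak mu 1 w (maximal (trapezoids adj omega beta) mu)).
Proof.
have [par [belowP dist succ levP]] := @tree_parent R T adj omega xs tree_T boundary_omega omega_xs.
case: flow_mu => mu0 flow; rewrite (trapezoids_bands beta tree_T belowP dist).
have mu_flow x : (mu x)%:E = \esum_(y in [set y | par y = x]) (mu y)%:E.
  by rewrite flow succ.
have beta4 : 4 <= beta by apply: le_trans beta_ge12; rewrite ler_nat.
have [N] := exists_pow2_ge beta (ltr01 : 0 < 1 :> R); rewrite mul1r => betaN.
split=> [p w p1 Ap|w A1].
- exact: (band_maximal_Ap levP mu0 mu_flow beta4 betaN).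
- exact: (band_maximal_A1 levP mu0 mu_flow beta4 betaN).
Qed.
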